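(* Let $M_1, M_2$ be simple matroids (no loops and no double points, i.e. no parallel elements) of rank $3$, each on a ground set of $N+1$ elements, and suppose that $$\mathrm{Trop}_{\Delta_1}(M_1)=\mathrm{Trop}_{\Delta_2}(M_2)\subset\mathbb R^N$$ (equality of subsets of $\mathbb R^N$) for some $\mathbb Z$-bases $\Delta_1,\Delta_2$ of $\mathbb Z^N$. Then $M_1$ and $M_2$ are isomorphic matroids.
   Context: For a loopless matroid $M$ of rank $3$ on the ground set $\{0,\dots,N\}$ and a $\mathbb Z$-basis $\Delta=\{u_1,\dots,u_N\}$ of $\mathbb Z^N$, put $u_0=-\sum_{i=1}^N u_i$ and $u_I=\sum_{i\in I}u_i$ for $I\subset\{0,\dots,N\}$. The Bergman fan $\mathrm{Trop}_\Delta(M)\subset\mathbb R^N$ is the set which is the union, over all flags of flats $\emptyset\subsetneq F_{I_1}\subsetneq\dots\subsetneq F_{I_l}\subsetneq\{0,\dots,N\}$ of $M$, of the cones spanned by $u_{I_1},\dots,u_{I_l}$. It is two-dimensional, and only its support (not a fan structure) is considered. A fan tropical plane in $\mathbb R^N$ is a set of this form. *)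

(* Defs.v *)
From mathcomp Require Import classical_sets reals.
From mathcomp Require Import all_boot all_order all_algebra.
Set Implicit Arguments.
Unset Strict Implicit.
Unset Printing Implicit Defensive.
Import GRing.Theory Num.Theory.
Local Open Scope ring_scope.

Record matroid (T : finType) := Matroid {
  indep : {set {set T}};
  indep0 : set0 \in indep;
  indepS : forall A B : {set T}, A \subset B -> B \in indep -> A \in indep;
  indep_augment : forall A B : {set T}, A \in indep -> B \in indep ->
    (#|A| < #|B|)%N -> exists2 x, x \in B :\: A & x |: A \in indep }.

Definition mrank (T : finType) (M : matroid T) (A : {set T}) : nat :=
  (\max_(I in indep M | I \subset A) #|I|)%N.

Definition is_flat (T : finType) (M : matroid T) (F : {set T}) : Prop :=
  forall x, x \notin F -> (mrank M F < mrank M (x |: F))%N.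

Definition loop (T : finType) (M : matroid T) (x : T) : Prop :=
  [set x] \notin indep M.

Definition parallel (T : finType) (M : matroid T) (x y : T) : Prop :=
  [/\ x != y, ~ loop M x, ~ loop M y & [set x; y] \notin indep M].

Definition simple_matroid (T : finType) (M : matroid T) : Prop :=
  (forall x, ~ loop M x) /\ (forall x y, ~ parallel M x y).

Definition isomorphic_matroids (T1 T2 : finType)
    (M1 : matroid T1) (M2 : matroid T2) : Prop :=
  exists f : T1 -> T2, bijective f /\
    forall A : {set T1}, (A \in indep M1) = (f @: A \in indep M2).

Definition Zbasis (N : nat) (u : 'I_N -> 'rV[int]_N) : Prop :=
  forall v : 'rV[int]_N,
    exists! c : 'rV[int]_N, v = \sum_(i < N) c 0 i *: u i.

(* The basis vectors u_1, ..., u_N are listed by 'I_N, so that u_i is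
   u (i - 1) for i > 0, while u_0 is minus their sum. *)
Definition ray (N : nat) (u : 'I_N -> 'rV[int]_N) (i : 'I_N.+1) : 'rV[int]_N :=
  if unlift ord0 i is Some j then u j else - \sum_(j < N) u j.

Definition ray_sum (R : realType) (N : nat) (u : 'I_N -> 'rV[int]_N)
    (I : {set 'I_N.+1}) : 'rV[R]_N :=
  map_mx (fun z : int => z%:~R) (\sum_(i in I) ray u i).

Definition flag_of_flats (T : finType) (M : matroid T) (s : seq {set T}) : Prop :=
  path (fun A B : {set T} => A \proper B) set0 (rcons s [set: T]) /\
  forall F, F \in s -> is_flat M F.

Definition cone (R : realType) (N : nat) (u : 'I_N -> 'rV[int]_N)
    (s : seq {set 'I_N.+1}) : set 'rV[R]_N :=
  [set x : 'rV[R]_N | exists c : {set 'I_N.+1} -> R, (forall F, 0 <= c F) /\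
     x = \sum_(F <- s) c F *: ray_sum R u F]%classic.
Arguments cone R [N] u s _.

(* Defined for every rank; the empty flag only contributes the origin. *)
Definition Trop (R : realType) (N : nat) (u : 'I_N -> 'rV[int]_N)
    (M : matroid 'I_N.+1) : set 'rV[R]_N :=
  [set x : 'rV[R]_N | exists2 s, flag_of_flats M s & cone R u s x]%classic.
Arguments Trop R [N] u M _.

(* Main.v *)
(* Read off the integral points of the fan the primitive vectors that are not
   the sum of two vectors spanning a pointed cone of the fan. They are the e_i,
   except for the points i lying on two lines that cover the ground set
   (hidden points), and the sums u_L over the lines L with at least three points
   (long lines), unless the complement of a point is a line. Join two of them
   when their sum is a nonzero point of the fan: e_i is joined to e_j when {i, j}
   is a line and to u_L when i is in L, while u_L and u_L' are joined only when L
   and L' cross in a hidden point and cover the ground set.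
   With a hidden point this graph is complete bipartite, and the sizes of its
   parts determine the matroid. Without one, let X be the set of the points x
   with e_x = u'_L' for a long line L' of the second matroid, and B the set of
   the long lines L with u_L = e'_y. Comparing the sums of the neighbours of a
   vector shows that a point of X is on exactly two long lines, both in B, and
   symmetrically that a line of B contains exactly two points of X; since any
   two points of X are on a line of B, either X and B are empty or X is a
   triangle with sides B. In the latter case sum_y e'_y = 0 forces all other
   points onto exactly one side, and exchanging each vertex of the triangle with
   the opposite side (a quadratic Cremona transformation) carries the lines of
   the first matroid to those of the second. *)

Require Import Defs.
From mathcomp Require Import classical_sets reals.
From mathcomp Require Import all_boot all_order all_algebra.
From mathcomp Require Import perm.
From mathcomp Require Import zify.

Set Implicit Arguments.
Unset Strict Implicit.
Unset Printing Implicit Defensive.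
Import GRing.Theory Num.Theory.
Local Open Scope ring_scope.

(** * Linear spaces and integral weights *)

Record linear_space (T : finType) (Ls : {set {set T}}) : Prop := LinearSpace {
  line_gt1 : forall L, L \in Ls -> (1 < #|L|)%N;
  line_neqT : forall L, L \in Ls -> exists z, z \notin L;
  line_through : forall x y, x != y ->
    exists L, [/\ L \in Ls, x \in L & y \in L];
  line_uniq : forall x y L L', x != y -> L \in Ls -> L' \in Ls ->
    x \in L -> y \in L -> x \in L' -> y \in L' -> L = L';
  points_gt2 : (2 < #|T|)%N }.

Lemma neq_setTP (T : finType) (A : {set T}) : reflect (exists x, x \notin A) (A != setT).
Proof.
rewrite -subTset; apply: (iffP subsetPn) => [[x _ xA]|[x xA]]; first by exists x.
by exists x; rewrite ?inE.
Qed.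

Section Weights.
Variables (T : finType) (V : zmodType) (e : T -> V).

Definition wsum (f : T -> nat) : V := \sum_j e j *+ f j.
Definition flat_vec (S : {set T}) : V := \sum_(j in S) e j.

Lemma eq_wsum f g : f =1 g -> wsum f = wsum g.
Proof. by move=> fg; apply: eq_bigr => j _; rewrite fg. Qed.

Lemma wsumD f g : wsum f + wsum g = wsum (fun x => f x + g x)%N.
Proof. by rewrite /wsum -big_split; apply: eq_bigr => j _; rewrite mulrnDr. Qed.

Lemma wsumMn f a : wsum f *+ a = wsum (fun x => f x * a)%N.
Proof. by rewrite /wsum -sumrMnl; apply: eq_bigr => j _; rewrite mulrnA. Qed.

Lemma wsum0 : wsum (fun=> 0%N) = 0.
Proof. by rewrite /wsum big1. Qed.

Lemma flat_vecE S : flat_vec S = wsum (fun x => x \in S).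
Proof. by rewrite /flat_vec big_mkcond; apply: eq_bigr => j _; case: (j \in S). Qed.

Lemma vecE i : e i = wsum (fun x => x == i).
Proof.
rewrite /wsum (bigD1 i) //= eqxx mulr1n big1 ?addr0 // => j /negPf ->.
by rewrite mulr0n.
Qed.

Lemma flat_vec1 i : flat_vec [set i] = e i.
Proof. by rewrite /flat_vec big_set1. Qed.

End Weights.

(** The fan enters only through the predicate [P] on lattice points, the datum that two planes can
    share. [plane_frame] says that the relations between the [e i] are the multiples of
    [\sum_i e i = 0], written without subtraction so that weights stay in [nat]. *)
Record plane (T : finType) (V : zmodType) (P : V -> Prop) (e : T -> V)
    (Ls : {set {set T}}) : Prop := Plane {
  plane_lines :> linear_space Ls;
  plane_frame : forall f g : T -> nat,
    wsum e f = wsum e g <-> forall x y, (f x + g y = f y + g x)%N;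
  plane_points : forall v, P v <-> exists i L (a b : nat),
    [/\ L \in Ls, i \in L & v = e i *+ a + flat_vec e L *+ b] }.

(** * Irreducible vectors and adjacency, defined from the support alone *)

Section Irreducible.
Variables (V : zmodType) (P : V -> Prop).

(** Lattice form of the condition that [v] and [w] span a pointed cone inside the fan. Nonvanishing
    rules out the trivial splitting of [v] as [v + 0]; proportional vectors are allowed, so that
    non-primitive vectors are not irreducible. *)
Definition compatible (v w : V) : Prop :=
  forall a b : nat, (0 < a + b)%N -> P (v *+ a + w *+ b) /\ v *+ a + w *+ b != 0.

Definition irreducible (v : V) : Prop :=
  [/\ P v, v != 0 & forall w1 w2, compatible w1 w2 -> w1 + w2 != v].

Definition adjacent (v w : V) : Prop := [/\ v != w, v + w != 0 & P (v + w)].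

Lemma adjacentC v w : adjacent v w -> adjacent w v.
Proof. by case=> vw s0 Ps; split; [rewrite eq_sym | rewrite addrC | rewrite addrC]. Qed.

Lemma compatibleC v w : compatible v w -> compatible w v.
Proof. by move=> C a b ab; rewrite addrC; apply: C; rewrite addnC. Qed.

(* Subdividing the cone spanned by v and w along v + w. *)
Lemma compatible_star v w : compatible v (v + w) -> compatible w (v + w) ->
  compatible v w.
Proof.
move=> Cv Cw a b ab; case: (leqP b a) => h.
  have -> : v *+ a + w *+ b = v *+ (a - b) + (v + w) *+ b.
    by rewrite mulrnDl addrA -mulrnDr subnK.
  by apply: Cv; lia.
have -> : v *+ a + w *+ b = w *+ (b - a) + (v + w) *+ a.
  by rewrite mulrnDl addrCA -mulrnDr subnK // ltnW.
by apply: Cw; lia.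
Qed.
End Irreducible.

Section LinearSpace.
Variables (T : finType) (Ls : {set {set T}}).
Hypothesis LS : linear_space Ls.

Definition long (L : {set T}) : bool := (L \in Ls) && (2 < #|L|)%N.
Definition hidden (p : T) : bool :=
  [exists L in Ls, exists L' in Ls,
    [&& L != L', p \in L, p \in L' & L :|: L' == setT]].
Definition degenerate : bool := [exists b, [set~ b] \in Ls].

Lemma other_point x (L : {set T}) : L \in Ls -> exists2 y, y \in L & y != x.
Proof.
move=> LLs; have := line_gt1 LS LLs; rewrite (cardsD1 x) => h.
have : (0 < #|L :\ x|)%N by case: (x \in L) h; lia.
by case/card_gt0P=> y; rewrite !inE => /andP[yx yL]; exists y.
Qed.

Lemma two_points (L : {set T}) : L \in Ls -> exists x y, [/\ x \in L, y \in L & x != y].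
Proof.
move=> LLs; have /ltnW/card_gt0P[x xL] := line_gt1 LS LLs.
by have [y yL yx] := other_point x LLs; exists y, x.
Qed.

Lemma line_sub (L L' : {set T}) : L \in Ls -> L' \in Ls -> L \subset L' -> L = L'.
Proof.
move=> LLs L'Ls /subsetP s; have [x [y [xL yL xy]]] := two_points LLs.
by apply: (line_uniq LS xy); rewrite ?s.
Qed.

Lemma meet_uniq (L L' : {set T}) x y : L \in Ls -> L' \in Ls -> L != L' ->
  x \in L -> x \in L' -> y \in L -> y \in L' -> x = y.
Proof.
move=> LLs L'Ls LL' *; apply/eqP; apply: contraNT LL' => xy.
by apply/eqP; apply: (line_uniq LS xy).
Qed.

Lemma point_on_line x : exists2 L, L \in Ls & x \in L.
Proof.
have /card_gt0P[y] : (0 < #|~: [set x]|)%N.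
  by have := points_gt2 LS; have := cardsC [set x]; rewrite cards1; lia.
rewrite !inE eq_sym => xy; have [L [LLs xL _]] := line_through LS xy.
by exists L.
Qed.

Lemma third_point (x y : T) : exists z, (z != x) && (z != y).
Proof.
have : (0 < #|~: [set x; y]|)%N.
  have := points_gt2 LS; have := cardsC [set x; y]; rewrite cards2.
  by case: (x != y); lia.
by case/card_gt0P=> z; rewrite !inE negb_or; exists z.
Qed.

Lemma short_not_long x y L : x != y -> [set x; y] \in Ls -> long L ->
  x \in L -> y \in L -> False.
Proof.
move=> xy S /andP[LLs L3] xL yL.
have : [set x; y] = L by apply: (line_uniq LS xy); rewrite // !inE eqxx ?orbT.
by move=> eL; move: L3; rewrite -eL cards2 xy.
Qed.

Lemma long_or_short x y : x != y ->
  [set x; y] \in Ls \/ exists L, [/\ long L, x \in L & y \in L].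
Proof.
move=> xy; have [L [LLs xL yL]] := line_through LS xy.
case: (ltnP 2 #|L|) => h; first by right; exists L; rewrite /long LLs.
left; suff -> : [set x; y] = L by [].
by apply/eqP; rewrite eqEcard subUset !sub1set xL yL cards2 xy.
Qed.

End LinearSpace.

(** * Adjacency of integral points *)

Section Plane.
Variables (T : finType) (V : zmodType) (P : V -> Prop) (e : T -> V).
Variable Ls : {set {set T}}.
Hypothesis PL : plane P e Ls.

Let LS : linear_space Ls := plane_lines PL.
Local Notation u := (flat_vec e).

Lemma frameP f g :
  wsum e f = wsum e g <-> forall x y, (f x + g y = f y + g x)%N.
Proof. exact: plane_frame PL f g. Qed.

Lemma wsum_eq0 f : wsum e f = 0 <-> forall x y, f x = f y.
Proof.
rewrite -(wsum0 e) frameP; split=> h x y; first by have := h x y; lia.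
by rewrite (h x y).
Qed.

(** Modulo constants the weight is [a] times a point of a line [L] plus [b] times [L], so its
    superlevel sets are empty, that point, [L] or everything. Two points above the level and one
    below leave only [L]. This is how membership in the fan becomes collinearity. *)
Lemma level_line f x y z t : P (wsum e f) -> x != y ->
  (t <= f x)%N -> (t <= f y)%N -> (f z < t)%N ->
  exists2 L, L \in Ls & forall w, (w \in L) = (t <= f w)%N.
Proof.
case/(plane_points PL)=> i [L [a [b [LLs iL]]]].
rewrite (vecE e) flat_vecE !wsumMn wsumD => /frameP h xy tx ty fz.
exists L => // w.
wlog yi : x y xy tx ty / y != i.
  move=> H; case: (eqVneq y i) => [yi|]; last exact: (H x y).
  by apply: (H y x) => //; rewrite eq_sym // -yi eq_sym.
have {h} h : forall x, (f x + ((z == i) * a + (z \in L) * b) =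
  f z + ((x == i) * a + (x \in L) * b))%N by move=> v; have := h v z; lia.
have := h y; have := h w; rewrite (negPf yi).
have zL : z \notin L.
  by apply/negP=> zL; have := h y; rewrite zL (negPf yi); case: (y \in L); lia.
have zi : z != i by apply: contraNneq zL => ->.
rewrite (negPf zL) (negPf zi).
have yL : y \in L.
  by apply/negPn/negP=> yL; have := h y; rewrite (negPf yL) (negPf yi); lia.
rewrite yL; case: (boolP (w \in L)) => wL; last first.
  have -> : (w == i) = false by apply: contraNF wL => /eqP->.
  by lia.
by lia.
Qed.

(** Indicators with the same vector differ by a constant; a missing point on each side forces this
    constant to be 0. Without it [set0] and [setT] would be confused. *)
Lemma flat_vec_inj (S S' : {set T}) z z' : z \notin S -> z' \notin S' ->
  u S = u S' -> S = S'.
Proof.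
rewrite !flat_vecE => zS zS' /frameP h; apply/setP=> x; apply/idP/idP=> xS.
  by apply/negPn/negP=> /negPf xS'; have := h x z; rewrite xS xS' (negPf zS); lia.
by apply/negPn/negP=> /negPf xS'; have := h x z'; rewrite xS xS' (negPf zS'); lia.
Qed.

Lemma point_inj x y : e x = e y -> x = y.
Proof.
have [z /andP[zx zy]] := third_point LS x y.
rewrite -(flat_vec1 e x) -(flat_vec1 e y) => E.
have S : [set x] = [set y] by apply: flat_vec_inj E; rewrite inE; eassumption.
by apply/set1P; rewrite -S inE.
Qed.

Lemma line_vec_inj L L' : L \in Ls -> L' \in Ls -> u L = u L' -> L = L'.
Proof.
move=> /(line_neqT LS)[z zL] /(line_neqT LS)[z' zL']; exact: (flat_vec_inj zL zL').
Qed.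

Lemma point_neq_line x L : L \in Ls -> e x != u L.
Proof.
move=> LLs; have [z zL] := line_neqT LS LLs; have [y _ yx] := other_point LS x LLs.
apply/eqP; rewrite -(flat_vec1 e x) => E.
have S : [set x] = L by apply: (flat_vec_inj _ zL E); rewrite inE; exact: yx.
by have := line_gt1 LS LLs; rewrite -S cards1.
Qed.

Lemma P_flag i L a b : L \in Ls -> i \in L -> P (e i *+ a + u L *+ b).
Proof. by move=> *; apply/(plane_points PL); exists i, L, a, b. Qed.

Lemma P_line L b : L \in Ls -> P (u L *+ b).
Proof.
move=> LLs; have [x [_ [xL _ _]]] := two_points LS LLs.
by have := @P_flag x L 0 b LLs xL; rewrite mulr0n add0r.
Qed.

Lemma P_point i a : P (e i *+ a).
Proof.
have [L LLs iL] := point_on_line LS i.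
by have := @P_flag i L a 0 LLs iL; rewrite mulr0n addr0.
Qed.

Lemma flag_neq0 i L a b : L \in Ls -> i \in L -> (0 < a + b)%N ->
  e i *+ a + u L *+ b != 0.
Proof.
move=> LLs iL ab; rewrite (vecE e) flat_vecE !wsumMn wsumD; apply/eqP=> /wsum_eq0 h.
have [z zL] := line_neqT LS LLs; have := h i z.
have zi : z != i by apply: contraNneq zL => ->.
by rewrite eqxx iL (negPf zL) (negPf zi); lia.
Qed.

Lemma line_neq0 L : L \in Ls -> u L != 0.
Proof.
move=> LLs; have [x [_ [xL _ _]]] := two_points LS LLs.
by have := @flag_neq0 x L 0 1 LLs xL isT; rewrite mulr0n add0r.
Qed.

Lemma point_neq0 i : e i != 0.
Proof.
have [L LLs iL] := point_on_line LS i.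
by have := @flag_neq0 i L 1 0 LLs iL isT; rewrite mulr0n addr0.
Qed.

Lemma compatible_flag i L a b : L \in Ls -> i \in L -> (0 < a)%N -> (0 < b)%N ->
  compatible P (e i *+ a) (u L *+ b).
Proof.
move=> LLs iL a0 b0 c d cd; rewrite -!mulrnA; split; first exact: P_flag.
by apply: flag_neq0 => //; nia.
Qed.

(** The two indicators add up to 1 everywhere except for 2 at [p], and constant weights vanish. *)
Lemma setU_lines p L L' : L \in Ls -> L' \in Ls -> L != L' -> p \in L ->
  p \in L' -> L :|: L' = setT -> u L + u L' = e p.
Proof.
move=> LLs L'Ls LL' pL pL' LT; rewrite (vecE e) !flat_vecE wsumD; apply/frameP=> x y.
have H w : ((w \in L) + (w \in L') = 1 + (w == p))%N.
  have : w \in L :|: L' by rewrite LT inE.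
  rewrite inE; case: (boolP (w \in L)) => wL; case: (boolP (w \in L')) => wL' //= _.
  - by rewrite (meet_uniq LS LLs L'Ls LL' wL wL' pL pL') eqxx.
  - by case: eqP => // wp; rewrite wp pL' in wL'.
  - by case: eqP => // wp; rewrite wp pL in wL.
by have := H x; have := H y; lia.
Qed.

Lemma short_vec x y : x != y -> u [set x; y] = e x + e y.
Proof. by move=> xy; rewrite /flat_vec big_setU1 ?inE //= big_set1. Qed.

(** Everything else splits: a mixed vector along its flag, a proper multiple along its own ray, a
    two-point line into its points, a hidden [e p] as [u L1 + u L2]. In the last two cases
    compatibility comes from [compatible_star], the sum cutting the cone into two flag cones. *)
Lemma irreducible_cases v : irreducible P v ->
  (exists2 i, ~~ hidden Ls i & v = e i) \/ (exists2 L, long Ls L & v = u L).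
Proof.
case=> /(plane_points PL)[i [L [a [b [LLs iL ->]]]]] v0 irr.
case: b v0 irr => [|b] v0 irr; last first.
  case: a v0 irr => [|a] v0 irr; last first.
    by have := irr _ _ (@compatible_flag i L a.+1 b.+1 LLs iL isT isT); rewrite eqxx.
  case: b v0 irr => [|b]; rewrite mulr0n add0r => v0 irr.
    right; exists L; rewrite ?mulr1n // /long LLs /= ltnNge; apply/negP=> L2.
    have [y yL yi] := other_point LS i LLs.
    have eL : L = [set i; y].
      apply/esym/eqP; rewrite eqEcard subUset !sub1set iL yL cards2 eq_sym yi.
      by rewrite (leq_trans L2).
    move: irr; rewrite mulr1n eL short_vec 1?eq_sym // => /(_ (e i) (e y)).
    rewrite eqxx => irr; suff : false by [].
    apply: irr; apply: compatible_star;
      rewrite -short_vec 1?eq_sym // -eL -[e _]mulr1n -[u L]mulr1n;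
      exact: compatible_flag.
  have := irr (u L) (u L *+ b.+1); rewrite -mulrS eqxx => irr'.
  suff : false by []; apply: irr' => c d cd; rewrite -mulrnA -mulrnDr.
  split; first exact: P_line.
  by have := @flag_neq0 i L 0 (c + b.+1 * d) LLs iL; rewrite mulr0n add0r; apply; nia.
case: a v0 irr => [|[|a]]; rewrite mulr0n addr0 => v0 irr; first by rewrite eqxx in v0.
  left; exists i; rewrite ?mulr1n //; apply/negP=> /exists_inP[L1 L1s].
  case/exists_inP=> L2 L2s /and4P[L12 iL1 iL2 /eqP LT].
  have E := setU_lines L1s L2s L12 iL1 iL2 LT.
  have := irr (u L1) (u L2); rewrite E eqxx => irr'.
  suff : false by []; apply: irr'; apply: compatible_star; rewrite E;
    apply: compatibleC; rewrite -[e _]mulr1n -[u _]mulr1n; exact: compatible_flag.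
have := irr (e i) (e i *+ a.+1); rewrite -mulrS eqxx => irr'.
suff : false by []; apply: irr' => c d cd; rewrite -mulrnA -mulrnDr.
split; first exact: P_point.
have := @flag_neq0 i L (c + a.+1 * d) 0 LLs iL; rewrite mulr0n addr0; apply; nia.
Qed.

Lemma total_vec : u [set: T] = 0.
Proof. by rewrite flat_vecE; apply/wsum_eq0=> x y; rewrite !inE. Qed.

Lemma adjacent_points x y : x != y -> adjacent P (e x) (e y) <-> [set x; y] \in Ls.
Proof.
move=> xy; split=> [[_ _]|xyL]; last first.
  split; first by apply: contraNneq xy => /point_inj->.
    by rewrite -short_vec // line_neq0.
  by rewrite -short_vec // -[u _]mulr1n; apply: P_line.
rewrite -short_vec // flat_vecE => Ps; have [z /andP[zx zy]] := third_point LS x y.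
have [||| L LLs HL] := level_line (z := z) (t := 1) Ps xy.
- by rewrite !inE eqxx.
- by rewrite !inE eqxx orbT.
- by rewrite !inE (negPf zx) (negPf zy).
suff -> : [set x; y] = L by [].
by apply/setP=> w; rewrite HL; case: (w \in _).
Qed.

(** For [x] outside [L], the level set of the sum at height 1 would be a line strictly containing
    [L]. *)
Lemma adjacent_point_line x L : L \in Ls -> adjacent P (e x) (u L) <-> x \in L.
Proof.
move=> LLs; split=> [[_ s0 Ps]|xL]; last first.
  have H := @compatible_flag x L 1 1 LLs xL isT isT.
  by have [] := H 1%N 1%N isT; rewrite !mulr1n; split; rewrite ?point_neq_line.
apply/negPn/negP=> xL; have xLu : e x + u L = u (x |: L) by rewrite /flat_vec big_setU1.
(* When [L] is the complement of [x] the sum is 0, which lies in the fan; the clause [v + w != 0] of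
   [adjacent] excludes it. *)
have [xLT | /neq_setTP[z]] := eqVneq (x |: L) setT.
  by case/negP: s0; rewrite xLu xLT total_vec.
rewrite !inE => zxL; have [y [w [yL wL yw]]] := two_points LS LLs.
move: Ps; rewrite xLu flat_vecE => Ps.
have [||| K KLs HK] := level_line (z := z) (t := 1) Ps yw.
- by rewrite !inE yL orbT.
- by rewrite !inE wL orbT.
- by rewrite !inE (negPf zxL).
have LK : L = K by apply: (line_uniq LS yw); rewrite ?HK ?inE ?yL ?wL ?orbT.
by move: xL; rewrite LK HK !inE eqxx.
Qed.

(** Disjoint lines covering the ground set have sum 0. Lines that fail to cover it would both be
    contained in the level set at height 1, itself a line, and would coincide. *)
Lemma adjacent_lines L L' : L \in Ls -> L' \in Ls -> adjacent P (u L) (u L') ->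
  exists p, [/\ L != L', p \in L, p \in L' & L :|: L' = setT].
Proof.
move=> LLs L'Ls [nLL' s0 Ps].
have LL' : L != L' by apply: contraNneq nLL' => ->.
have [p pL pL'] : exists2 p, p \in L & p \in L'.
  apply/exists_inP; apply: contraT => H.
  have sE : u L + u L' = u (L :|: L').
    rewrite !flat_vecE wsumD; apply: eq_wsum => x; rewrite inE.
    case: (boolP (x \in L)) => xL //=; case: (boolP (x \in L')) => xL' //=.
    by case/negP: H; apply/exists_inP; exists x.
  have [LLT | /neq_setTP[z]] := eqVneq (L :|: L') setT.
    by case/negP: s0; rewrite sE LLT total_vec.
  rewrite !inE => zLL; have [y [w [yL wL yw]]] := two_points LS LLs.
  have [y' [w' [yL' wL' yw']]] := two_points LS L'Ls.
  move: Ps; rewrite sE flat_vecE => Ps.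
  have [||| K KLs HK] := level_line (z := z) (t := 1) Ps yw.
  - by rewrite !inE yL.
  - by rewrite !inE wL.
  - by rewrite !inE (negPf zLL).
  have LK : L = K by apply: (line_uniq LS yw); rewrite ?HK ?inE ?yL ?wL.
  have L'K : L' = K by apply: (line_uniq LS yw'); rewrite ?HK ?inE ?yL' ?wL' ?orbT.
  by case/negP: LL'; rewrite LK L'K.
exists p; split=> //; apply/setP=> z; rewrite !inE; apply: contraT => zLL.
have [y yL yp] := other_point LS p LLs; have [w wL' wp] := other_point LS p L'Ls.
have [||||| K KLs HK] := level_line (z := z) (t := 1) (x := p) (y := y)
  (f := fun x => (x \in L) + (x \in L'))%N.
- by move: Ps; rewrite !flat_vecE wsumD.
- by rewrite eq_sym.
- by rewrite pL.
- by rewrite yL.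
- by move: zLL; rewrite negb_or => /andP[/negPf-> /negPf->].
have LK : L = K by apply: (line_uniq LS yp); rewrite ?HK /= ?pL ?yL.
have L'K : L' = K by apply: (line_uniq LS wp); rewrite ?HK /= ?pL' ?wL' ?addn1 ?pL.
by case/negP: LL'; rewrite LK L'K.
Qed.

End Plane.

(** * Irreducibility of points and long lines in the nondegenerate case *)

Section Converse.
Variables (T : finType) (V : zmodType) (P : V -> Prop) (e : T -> V).
Variable Ls : {set {set T}}.
Hypothesis PL : plane P e Ls.
Hypothesis ND : ~~ degenerate Ls.

Let LS : linear_space Ls := plane_lines PL.
Local Notation u := (flat_vec e).

(** Otherwise [L] would be the complement of [i]. *)
Lemma uncovered i L : L \in Ls -> exists2 z, z != i & z \notin L.
Proof.
move=> LLs; apply/exists_inP; apply: contraNT ND => H.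
have {}H z : z = i \/ z \in L.
  case: (eqVneq z i) => zi; first by left.
  by right; apply: contraNT H => zL; apply/exists_inP; exists z.
have [z zL] := line_neqT LS LLs.
have iL : i \notin L by case: (H z) zL => [->//|->].
apply/existsP; exists i; rewrite (_ : [set~ i] = L) //.
apply/setP=> w; rewrite !inE; case: eqP => [->|wi]; first by rewrite (negPf iL).
by case: (H w).
Qed.

(** If [a] were positive, some positive combination would lift [i] to the level of [L2] while
    leaving another point of [L1] below, and a line would contain [L2] together with [i]. *)
Lemma compatible_disjoint_lines i j L1 L2 a b c d :
  L1 \in Ls -> L2 \in Ls -> i \in L1 -> j \in L2 ->
  (forall x, x \in L1 -> x \notin L2) ->
  compatible P (e i *+ a + u L1 *+ b) (e j *+ c + u L2 *+ d) -> (0 < d)%N -> a = 0%N.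
Proof.
move=> L1s L2s iL1 jL2 dis C d0; apply/eqP; apply: contraT; rewrite -lt0n => a0.
have [p1 p1L1 p1i] := other_point LS i L1s.
have [y [w [yL wL yw]]] := two_points LS L2s.
(* The multiplicities [d] and [b.+1] give height at least [b.+1 * d] on [L2] and at [i], but only
   [b * d] at [p1]. *)
pose f x := (((x == i) * a + (x \in L1) * b) * d +
    ((x == j) * c + (x \in L2) * d) * b.+1)%N.
have fL2 x : x \in L2 -> (b.+1 * d <= f x)%N.
  move=> xL; rewrite /f xL mul1n mulnC (leq_trans _ (leq_addl _ _)) //.
  by rewrite leq_mul2r leq_addl orbT.
have fi : (b.+1 * d <= f i)%N.
  rewrite /f eqxx iL1 !mul1n (leq_trans _ (leq_addr _ _)) //.
  by rewrite leq_mul2r -add1n leq_add2r a0 orbT.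
have fp1 : (f p1 < b.+1 * d)%N.
  have p1L2 := dis _ p1L1; rewrite /f p1L1 (negPf p1L2) (negPf p1i).
  have -> : (p1 == j) = false by apply: contraNF p1L2 => /eqP->.
  by rewrite !mul0n !mul1n !add0n addn0 ltn_mul2r d0 ltnSn.
have Pf : P (wsum e f).
  have [] := C d b.+1 _; first by rewrite addnS.
  by rewrite !(vecE e) !flat_vecE !(wsumMn, wsumD).
have [K KLs HK] := level_line PL Pf yw (fL2 _ yL) (fL2 _ wL) fp1.
have KL2 : L2 = K by apply: (line_uniq LS yw); rewrite // HK fL2.
by have := dis i iL1; rewrite KL2 HK fi.
Qed.

(** The last premise says that the vector of [S] is a sum of two flag vectors. If the weight [g] of
    this sum vanishes somewhere, it is the indicator of [S], and neither a point nor a long line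
    splits like that. Otherwise the two lines cover everything, and a common point would make [S] a
    hidden point or a line without a second point. *)
Lemma splitting_disjoint S s i j L1 L2 (a b c d : nat) :
  (exists2 k, ~~ hidden Ls k & S = [set k]) \/ long Ls S -> s \notin S ->
  L1 \in Ls -> L2 \in Ls -> i \in L1 -> j \in L2 ->
  (0 < a + b)%N -> (0 < c + d)%N ->
  (forall x y,
    (x == i) * a + (x \in L1) * b + ((x == j) * c + (x \in L2) * d) + (y \in S) =
    (y == i) * a + (y \in L1) * b + ((y == j) * c + (y \in L2) * d) + (x \in S))%N ->
  [/\ (0 < b)%N, (0 < d)%N, forall x, x \in L1 -> x \notin L2 &
      forall x, (x \in L1) || (x \in L2)].
Proof.
move=> HS sS L1s L2s iL1 jL2 ab cd H.
have [g gE] : exists g : T -> nat, forall x, g x = ((x == i) * a + (x \in L1) * b + ((x == j) * c + (x \in L2) * d))%N.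
  by eexists.
have {}H x y : (g x + (y \in S) = g y + (x \in S))%N .
  by rewrite !gE; apply: H.
have gL1 x : x \in L1 -> (b <= g x)%N.
  by move=> xL; rewrite gE xL mul1n -addnA addnCA leq_addr.
have gL2 x : x \in L2 -> (d <= g x)%N.
  by move=> xL; rewrite gE xL mul1n !addnA leq_addl.
have gL12 x : x \in L1 -> x \in L2 -> (b + d <= g x)%N.
  by move=> x1 x2; rewrite gE x1 x2 !mul1n leq_add ?leq_addl.
have gi : (a + b <= g i)%N by rewrite gE eqxx iL1 !mul1n leq_addr.
have gj : (c + d <= g j)%N by rewrite gE eqxx jL2 !mul1n leq_addl.
have giL2 : i \in L2 -> (a + b + d <= g i)%N.
  by move=> i2; rewrite gE eqxx iL1 i2 !mul1n leq_add2l leq_addl.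
have gjL1 : j \in L1 -> (b + (c + d) <= g j)%N.
  by move=> j1; rewrite gE eqxx jL2 j1 !mul1n leq_add2r leq_addl.
have g_off x : x != i -> x != j -> g x = ((x \in L1) * b + (x \in L2) * d)%N.
  by move=> /negPf xi /negPf xj; rewrite gE xi xj.
have g_ij : i = j -> (a + b + (c + d) <= g i)%N.
  by move=> ij; rewrite gE -ij eqxx iL1 ij jL2 !mul1n.
clear gE.
case: (boolP [exists z, g z == 0%N]) => [/existsP[z /eqP gz]|/existsPn gpos].
  have zS : z \notin S.
    by apply/negP=> zS; have := H s z; rewrite gz zS (negPf sS) addn1.
  have gS x : g x = (x \in S) by have := H x z; rewrite gz (negPf zS) addn0 add0n.
  have iS : i \in S.
    by rewrite -[_ \in _]lt0b -gS (leq_trans ab).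
  have jS : j \in S.
    by rewrite -[_ \in _]lt0b -gS (leq_trans cd).
  have ij : i != j.
    by apply/eqP=> /g_ij; rewrite gS iS; move: ab cd; clear; lia.
  case: HS => [[k _ Sk]|SL].
    by case/negP: ij; move: iS jS; rewrite Sk !inE => /eqP-> /eqP->.
  case/andP: (SL) => SLs S3.
  have b0 : b = 0%N.
    apply/eqP; apply: contraT; rewrite -lt0n => b0.
    have LS1 : L1 = S.
      apply: (line_sub LS) => //; apply/subsetP=> x /gL1 bx.
      by rewrite -[_ \in _]lt0b -gS (leq_trans b0).
    have jL1 : j \in L1 by rewrite LS1.
    by have := gjL1 jL1; rewrite gS jS; move: b0 cd; clear; lia.
  have d0 : d = 0%N.
    apply/eqP; apply: contraT; rewrite -lt0n => d0.
    have LS2 : L2 = S.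
      apply: (line_sub LS) => //; apply/subsetP=> x /gL2 bx.
      by rewrite -[_ \in _]lt0b -gS (leq_trans d0).
    have iL2 : i \in L2 by rewrite LS2.
    by have := giL2 iL2; rewrite gS iS; move: d0 ab; clear; lia.
  have /subset_leq_card : S \subset [set i; j].
    apply/subsetP=> x xS; rewrite !inE; apply: contraT; rewrite negb_or.
    by case/andP=> xi xj; have := g_off x xi xj; rewrite gS xS b0 d0 !muln0.
  by rewrite cards2 ij leqNgt S3.
have b0 : (0 < b)%N.
  rewrite lt0n; apply/eqP=> b0; have [z zi zL2] := uncovered i L2s.
  have zj : z != j by apply: contraNneq zL2 => ->.
  by have /negP := gpos z; apply; rewrite g_off // b0 (negPf zL2) muln0.
have d0 : (0 < d)%N.
  rewrite lt0n; apply/eqP=> d0; have [z zj zL1] := uncovered j L1s.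
  have zi : z != i by apply: contraNneq zL1 => ->.
  by have /negP := gpos z; apply; rewrite g_off // d0 (negPf zL1) muln0.
have cov z : (z \in L1) || (z \in L2).
  apply: contraT; rewrite negb_or => /andP[z1 z2].
  have zj : z != j by apply: contraNneq z2 => ->.
  have zi : z != i by apply: contraNneq z1 => ->.
  by have /negP := gpos z; case; rewrite g_off // (negPf z1) (negPf z2).
(* Here [p1] lies only on [L1] and [p2] only on [L2], away from [i] and [j], so [g] takes there the
   exact values [b] and [d]. *)
have [p1 p1i p1L2] := uncovered i L2s; have [p2 p2j p2L1] := uncovered j L1s.
have p1L1 : p1 \in L1 by have := cov p1; rewrite (negPf p1L2) orbF.
have p2L2 : p2 \in L2 by have := cov p2; rewrite (negPf p2L1).
have p1j : p1 != j by apply: contraNneq p1L2 => ->.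
have p2i : p2 != i by apply: contraNneq p2L1 => ->.
have L12 : L1 != L2 by apply: contraNneq p1L2 => <-.
have gp1 : g p1 = b by rewrite g_off // p1L1 (negPf p1L2) mul1n addn0.
have gp2 : g p2 = d by rewrite g_off // p2L2 (negPf p2L1) mul1n.
split=> // p pL1; apply/negP=> pL2.
have h : [/\ p \in S, p1 \notin S & p2 \notin S].
  have := gL12 p pL1 pL2; have := H p p1; have := H p p2; rewrite gp1 gp2.
  move: b0 d0; clear; case: (p \in S); case: (p1 \in S); case: (p2 \in S) => /=;
    by [lia | split].
have [pS p1S p2S] := h.
case: HS => [[k hk Sk]|/andP[SLs S3]].
  move: pS; rewrite Sk inE => /eqP pk; case/negP: hk; rewrite -pk.
  apply/exists_inP; exists L1 => //; apply/exists_inP; exists L2 => //.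
  by rewrite L12 pL1 pL2; apply/eqP/setP=> z; rewrite !inE cov.
have SL1 : S != L1 by apply: contraNneq p1S => ->.
have SL2 : S != L2 by apply: contraNneq p2S => ->.
have [q qS qp] := other_point LS p SLs; case/orP: (cov q) => qL.
  by case/negP: qp; apply/eqP/(meet_uniq LS SLs L1s).
by case/negP: qp; apply/eqP/(meet_uniq LS SLs L2s).
Qed.

(** By the two previous lemmas a splitting would have the form [u L1 *+ b + u L2 *+ d] with [L1] and
    [L2] complementary, and such summands do not span a pointed cone. *)
Lemma irreducible_flat S : (exists2 i, ~~ hidden Ls i & S = [set i]) \/ long Ls S ->
  irreducible P (u S).
Proof.
move=> HS; have [s sS] : exists s, s \notin S.
  case: HS => [[i _ ->]|/andP[SLs _]]; last exact: line_neqT LS _ SLs.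
  by have [z /andP[zi _]] := third_point LS i i; exists z; rewrite inE.
split.
- case: HS => [[i _ ->]|/andP[SLs _]].
    by rewrite flat_vec1 -[e i]mulr1n; apply: P_point PL _ _.
  by rewrite -[u S]mulr1n; apply: P_line PL _ _ _.
- case: HS => [[i _ ->]|/andP[SLs _]]; last exact: line_neq0 PL _ _.
  by rewrite flat_vec1; apply: point_neq0 PL _.
move=> w1 w2 C; apply/eqP.
have Pw1 : P w1 /\ w1 != 0 by have := C 1%N 0%N isT; rewrite mulr1n mulr0n addr0.
have Pw2 : P w2 /\ w2 != 0 by have := C 0%N 1%N isT; rewrite mulr1n mulr0n add0r.
case: Pw1 => /(plane_points PL)[i [L1 [a [b [L1s iL1 E1]]]]] w1n.
case: Pw2 => /(plane_points PL)[j [L2 [c [d [L2s jL2 E2]]]]] w2n.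
have ab : (0 < a + b)%N.
  by apply: contraNltn w1n; rewrite leqn0 addn_eq0 E1 => /andP[/eqP-> /eqP->]; rewrite !mulr0n addr0.
have cd : (0 < c + d)%N.
  by apply: contraNltn w2n; rewrite leqn0 addn_eq0 E2 => /andP[/eqP-> /eqP->]; rewrite !mulr0n addr0.
rewrite E1 E2 !(vecE e) !flat_vecE !(wsumMn, wsumD) => /(frameP PL) H.
have [b0 d0 dis12 cov] := splitting_disjoint HS sS L1s L2s iL1 jL2 ab cd H.
have dis21 x : x \in L2 -> x \notin L1.
  by apply: contraL => /dis12.
have C' := C; rewrite E1 E2 in C'.
have a0 := compatible_disjoint_lines L1s L2s iL1 jL2 dis12 C' d0.
have c0 := compatible_disjoint_lines L2s L1s jL2 iL1 dis21 (compatibleC C') b0.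
have db : (0 < d + b)%N by rewrite addn_gt0 d0.
(* With coefficients [d] and [b] the combination has constant weight [b * d], hence is 0. *)
have [_ /eqP[]] := C d b db.
rewrite E1 E2 a0 c0 !flat_vecE !(vecE e) !(wsumMn, wsumD).
apply/(wsum_eq0 PL) => x y.
have E z : ((z \in L1) + (z \in L2) = 1)%N.
  have := cov z; case: (boolP (z \in L1)) => [/dis12/negPf->//|_].
  by case: (z \in L2).
have W z : (((z == i) * 0 + (z \in L1) * b) * d +
    ((z == j) * 0 + (z \in L2) * d) * b = b * d)%N.
  by rewrite !muln0 !add0n -!mulnA (mulnC d) -mulnDl E mul1n.
by rewrite !W.
Qed.

Lemma irreducible_point i : ~~ hidden Ls i -> irreducible P (e i).
Proof. by move=> hi; rewrite -(flat_vec1 e i); apply: irreducible_flat; left; exists i. Qed.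

Lemma irreducible_line L : long Ls L -> irreducible P (u L).
Proof. by move=> lL; apply: irreducible_flat; right. Qed.

End Converse.

(** * Hidden points *)

Section Crossing.
Variables (T : finType) (Ls : {set {set T}}).
Hypothesis LS : linear_space Ls.

Definition crossing (p : T) (L1 L2 : {set T}) : Prop :=
  [/\ L1 \in Ls, L2 \in Ls & L1 != L2] /\
  [/\ p \in L1, p \in L2 & L1 :|: L2 = setT].

Lemma hiddenP p : reflect (exists L1 L2, crossing p L1 L2) (hidden Ls p).
Proof.
apply: (iffP exists_inP) => [[L1 L1s /exists_inP[L2 L2s /and4P[L12 p1 p2 /eqP LT]]]|].
  by exists L1, L2.
case=> L1 [L2 [[L1s L2s L12] [p1 p2 LT]]]; exists L1 => //.
by apply/exists_inP; exists L2; rewrite // L12 p1 p2 LT eqxx.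
Qed.

Lemma crossingC p L1 L2 : crossing p L1 L2 -> crossing p L2 L1.
Proof. by case=> -[? ? ?] [? ? ?]; split; split; rewrite // 1?eq_sym // setUC. Qed.

Lemma card_meet (K L : {set T}) : K \in Ls -> L \in Ls -> K != L -> (#|K :&: L| <= 1)%N.
Proof.
move=> KLs LLs KL; rewrite leqNgt; apply/negP=> /card_gt1P[x [y []]].
rewrite !inE => /andP[xK xL] /andP[yK yL] /eqP[].
exact: (meet_uniq LS KLs LLs).
Qed.

Lemma line_cover_le2 (K A B : {set T}) : K \in Ls -> A \in Ls -> B \in Ls ->
  A :|: B = setT -> K != A -> K != B -> (#|K| <= 2)%N.
Proof.
move=> KLs ALs BLs AB KA KB; rewrite -[K]setIT -AB setIUr.
apply: leq_trans (leq_card_setU (K :&: A) (K :&: B)).1 _.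
exact: leq_add (card_meet KLs ALs KA) (card_meet KLs BLs KB).
Qed.

Section Lines.
Variables (p : T) (L1 L2 : {set T}).
Hypothesis X : crossing p L1 L2.

Lemma crossing_meet x : x \in L1 -> x \in L2 -> x = p.
Proof.
by case: X => -[L1s L2s L12] [p1 p2 _] x1 x2; apply: (meet_uniq LS L1s L2s).
Qed.

Lemma crossing_card : (#|L1| + #|L2| = #|T|.+1)%N.
Proof.
case: X => _ [p1 p2 LT]; rewrite -cardsUI LT cardsT.
suff -> : L1 :&: L2 = [set p] by rewrite cards1 addn1.
apply/setP=> x; rewrite !inE; apply/andP/eqP => [[x1 x2]|->//].
exact: crossing_meet.
Qed.

Lemma crossing_long L : long Ls L -> L = L1 \/ L = L2.
Proof.
case: X => -[L1s L2s _] [_ _ LT] /andP[LLs L3].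
have [->|n1] := eqVneq L L1; first by left.
have [->|n2] := eqVneq L L2; first by right.
by have := line_cover_le2 LLs L1s L2s LT n1 n2; rewrite leqNgt L3.
Qed.

Lemma crossing_cover x : (x \in L1) || (x \in L2).
Proof. by case: X => _ [_ _ LT]; have := in_setT x; rewrite -LT inE. Qed.

End Lines.
End Crossing.

(** * The complete bipartite graph of a hidden point *)

Section Sides.
Variables (T : finType) (V : zmodType) (P : V -> Prop) (e : T -> V).
Variable Ls : {set {set T}}.
Hypothesis PL : plane P e Ls.
Let LS : linear_space Ls := plane_lines PL.
Local Notation u := (flat_vec e).

(** One part of the bipartite graph. The vector of a line goes with the points of the other line,
    because a point is not adjacent to a line that avoids it. *)
Definition side (p : T) (L1 L2 : {set T}) : seq V :=
  u L1 :: [seq e b | b <- enum (L2 :\ p)].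

Lemma sideP p (L1 L2 : {set T}) v :
  reflect (v = u L1 \/ exists b, [/\ b \in L2, b != p & v = e b]) (v \in side p L1 L2).
Proof.
rewrite inE; apply: (iffP orP) => [[/eqP|/mapP[b]]|[/eqP|[b [bL bp ->]]]].
- by left.
- by rewrite mem_enum !inE => /andP[bp bL] ->; right; exists b.
- by left.
- by right; apply/mapP; exists b; rewrite // mem_enum !inE bp.
Qed.

Lemma crossing_irreducible p L1 L2 v : crossing Ls p L1 L2 -> irreducible P v ->
  v \in side p L1 L2 \/ v \in side p L2 L1.
Proof.
move=> X /(irreducible_cases PL)[[i hi ->]|[L lL ->]].
  have ip : i != p by apply: contraNneq hi => ->; apply/hiddenP; exists L1, L2.
  case/orP: (crossing_cover X i) => iL; [right | left]; apply/sideP; right;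
  by exists i.
by case: (crossing_long LS X lL) => ->; [left | right]; apply/sideP; left.
Qed.

Lemma side_not_adjacent p L1 L2 v w : crossing Ls p L1 L2 ->
  v \in side p L1 L2 -> w \in side p L1 L2 -> ~ adjacent P v w.
Proof.
move=> X; have [[L1s L2s L12] [p1 p2 LT]] := X.
have off b : b \in L2 -> b != p -> b \notin L1.
  by move=> bL; apply: contraNN => b1; apply/eqP; apply: (crossing_meet LS X b1 bL).
have pt_line b : b \in L2 -> b != p -> ~ adjacent P (e b) (u L1).
  move=> bL bp /(adjacent_point_line PL _ L1s).
  exact/negP/off.
case/sideP=> [->|[b [bL bp ->]]] /sideP[->|[b' [bL' bp' ->]]].
- by case=> /eqP.
- by move/adjacentC; apply: pt_line.
- exact: pt_line.
have [->|bb'] := eqVneq b b'; first by case=> /eqP.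
move/(adjacent_points PL bb') => S.
have E : [set b; b'] = L2 by apply: (line_uniq LS bb'); rewrite // !inE eqxx ?orbT.
by move: p2; rewrite -E !inE eq_sym (negPf bp) eq_sym (negPf bp').
Qed.

(** The two lines sum to [e p]; a line joining a point of each meets [L1] and [L2] only once, so it
    has no third point. *)
Lemma side_adjacent p L1 L2 v w : crossing Ls p L1 L2 ->
  v \in side p L1 L2 -> w \in side p L2 L1 -> adjacent P v w.
Proof.
move=> X; have [[L1s L2s L12] [p1 p2 LT]] := X.
case/sideP=> [->|[b [bL bp ->]]] /sideP[->|[a [aL ap ->]]].
- have E := setU_lines PL L1s L2s L12 p1 p2 LT.
  split; rewrite ?E ?(point_neq0 PL) //; last by rewrite -[e p]mulr1n; apply: P_point PL _ _.
  by apply: contraNneq L12 => /(line_vec_inj PL L1s L2s)->.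
- by apply: adjacentC; apply/(adjacent_point_line PL _ L1s).
- exact/(adjacent_point_line PL _ L2s).
have ab : b != a.
  by apply: contraNneq bp => ba; apply/eqP; apply: (crossing_meet LS X); rewrite // ba.
apply/(adjacent_points PL ab).
have [L [LLs bL' aL']] := line_through LS ab.
suff -> : [set b; a] = L by [].
apply/setP=> x; rewrite !inE; apply/orP/idP=> [[/eqP->|/eqP->]//|xL].
case/orP: (crossing_cover X x) => xL'; [right | left]; apply/eqP.
  have n : L != L1.
    by apply: contraNneq bp => E; apply/eqP; apply: (crossing_meet LS X); rewrite // -E.
  exact: (meet_uniq LS LLs L1s n).
have n : L != L2.
  by apply: contraNneq ap => E; apply/eqP; apply: (crossing_meet LS X); rewrite // -E.
exact: (meet_uniq LS LLs L2s n).
Qed.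

(** The graph as a 2-colouring. This covers degenerate planes too, where a side may contain
    reducible vectors. *)
Lemma adjacent_side p L1 L2 v w : crossing Ls p L1 L2 ->
  irreducible P v -> irreducible P w ->
  adjacent P v w <-> (v \in side p L1 L2) != (w \in side p L1 L2).
Proof.
move=> X iv iw; have X' := crossingC X.
have dis z : z \in side p L2 L1 -> (z \in side p L1 L2) = false.
  by move=> z2; apply/negP=> z1; case: (side_adjacent X z1 z2) => /eqP.
have [v1|v2] := crossing_irreducible X iv; have [w1|w2] := crossing_irreducible X iw.
- by rewrite v1 w1; split=> // /(side_not_adjacent X v1 w1).
- by rewrite v1 (dis _ w2); split=> // _; apply: side_adjacent X _ _.
- by rewrite w1 (dis _ v2); split=> // _; apply: side_adjacent X' _ _.
- by rewrite (dis _ w2) (dis _ v2); split=> // /(side_not_adjacent X' v2 w2).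
Qed.

Lemma side_size p L1 L2 : crossing Ls p L1 L2 -> size (side p L1 L2) = #|L2|.
Proof.
by case=> _ [_ p2 _]; rewrite /= size_map -cardE (cardsD1 p L2) p2.
Qed.

Lemma side_uniq p L1 L2 : crossing Ls p L1 L2 -> uniq (side p L1 L2).
Proof.
case=> -[L1s _ _] _; rewrite /= map_inj_uniq ?enum_uniq ?andbT.
  by apply/mapP=> -[b _] /esym/eqP; apply/negP; apply: point_neq_line PL _ _ _.
by move=> x y; apply: point_inj PL _ _.
Qed.

Hypothesis ND : ~~ degenerate Ls.

Lemma crossing_card_gt2 p L1 L2 : crossing Ls p L1 L2 -> (2 < #|L1|)%N.
Proof.
move=> X; have [[L1s L2s L12] [p1 p2 LT]] := X.
have [q q1 qp] := other_point LS p L1s; have [z zq z2] := uncovered PL ND q L2s.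
have z1 : z \in L1 by have := crossing_cover X z; rewrite (negPf z2) orbF.
have zp : z != p by apply: contraNneq z2 => ->.
by apply/card_gt2P; exists p, q, z; split; split; rewrite // eq_sym.
Qed.

(** If [b] were hidden, two lines through [b] would cover [L1], which avoids [b], and [L1] would
    have at most two points. *)
Lemma side_irreducible p L1 L2 v : crossing Ls p L1 L2 -> v \in side p L1 L2 ->
  irreducible P v.
Proof.
move=> X; have [[L1s L2s L12] [p1 p2 LT]] := X; have L3 := crossing_card_gt2 X.
case/sideP=> [->|[b [bL bp ->]]].
  by apply: (irreducible_line PL ND); rewrite /long L1s.
apply: (irreducible_point PL ND); apply/hiddenP=> -[K [K' [[Ks Ks' KK'] [bK bK' KT]]]].
have b1 : b \notin L1.
  by apply: contraNN bp => b1; apply/eqP; apply: (crossing_meet LS X b1 bL).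
have n : L1 != K by apply: contraNneq b1 => ->.
have n' : L1 != K' by apply: contraNneq b1 => ->.
by have := line_cover_le2 LS L1s Ks Ks' KT n n'; rewrite leqNgt L3.
Qed.

End Sides.

(** Two points are always collinear, so only larger sets carry information. *)
Definition preserves_lines (T : finType) (Ls Ls' : {set {set T}}) (phi : T -> T) :=
  forall A : {set T}, (2 < #|A|)%N ->
    (exists2 L, L \in Ls & A \subset L) <->
    (exists2 L', L' \in Ls' & phi @: A \subset L').

Lemma recolor (T : finType) (C : eqType) (f g : T -> C) :
  perm_eq (map f (enum T)) (map g (enum T)) ->
  exists2 phi : T -> T, bijective phi & forall x, g (phi x) = f x.
Proof.
pose t h := [tuple (h : T -> C) (enum_val i) | i < #|T|].
have tE h : perm_eq (t h) (map h (enum T)).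
  rewrite /= (map_comp h enum_val); apply/perm_map/uniq_perm.
  - by rewrite map_inj_uniq ?enum_uniq //; apply: enum_val_inj.
  - exact: enum_uniq.
  move=> x; rewrite mem_enum inE; apply/mapP; exists (enum_rank x).
    by rewrite mem_enum.
  by rewrite enum_rankK.
move=> fg; have /tuple_permP[s E] : perm_eq (t f) (t g).
  by rewrite (permPl (tE f)) (permPr (tE g)).
exists (fun x => enum_val (s (enum_rank x))).
  apply: injF_bij => x y /enum_val_inj /perm_inj; exact: enum_rank_inj.
move=> x; have /(congr1 (fun z => tnth z (enum_rank x))) := val_inj (E : val _ = val _).
by rewrite !tnth_mktuple enum_rankK.
Qed.

(** A point is coloured by its membership in the two lines. The colour classes have sizes 1,
    [#|L1|.-1] and [#|L2|.-1], and by [crossing_long] the colours determine all collinear sets of at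
    least three points. *)
Lemma recolor_crossing (T : finType) (Ls Ls' : {set {set T}}) p p' L1 L2 L1' L2' :
  linear_space Ls -> linear_space Ls' ->
  crossing Ls p L1 L2 -> crossing Ls' p' L1' L2' -> #|L1| = #|L1'| -> #|L2| = #|L2'| ->
  exists2 phi : T -> T, bijective phi & preserves_lines Ls Ls' phi.
Proof.
move=> LS LS' X X' c1 c2.
have colors Ks q K1 K2 : linear_space Ks -> crossing Ks q K1 K2 ->
    perm_eq (map (fun x => (x \in K1, x \in K2)) (enum T))
      ((true, true) :: nseq #|K1|.-1 (true, false) ++ nseq #|K2|.-1 (false, true)).
  move=> KS Y; have [[K1s K2s _] [q1 q2 KT]] := Y.
  have on1 x : x != q -> x \in K1 -> (x \in K2) = false.
    by move=> xq x1; apply: contraNF xq => x2; apply/eqP; apply: (crossing_meet KS Y).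
  have on2 x : x != q -> x \in K2 -> (x \in K1) = false.
    by move=> xq x2; apply: contraNF xq => x1; apply/eqP; apply: (crossing_meet KS Y).
  have E : perm_eq (enum T) (q :: enum (K1 :\ q) ++ enum (K2 :\ q)).
    apply: uniq_perm; rewrite ?enum_uniq //=.
      rewrite mem_cat !mem_enum !inE eqxx /= cat_uniq !enum_uniq andbT /=.
      apply/hasPn=> x; rewrite !mem_enum !inE => /andP[xq x2]; rewrite xq /=.
      by rewrite on2.
    move=> x; rewrite inE mem_cat !mem_enum !inE.
    by case: eqVneq => //= _; rewrite (crossing_cover Y).
  rewrite (permPl (perm_map _ E)) /= q1 q2 perm_cons map_cat.
  have const (A : {set T}) c : (forall x, x \in A -> (x \in K1, x \in K2) = c) ->
      [seq (x \in K1, x \in K2) | x <- enum A] = nseq #|A| c.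
    move=> h; rewrite cardE -(size_map (fun x => (x \in K1, x \in K2))).
    apply/all_pred1P/allP=> y /mapP[x]; rewrite mem_enum => /h cx ->.
    by rewrite /= cx.
  rewrite (const _ (true, false)) ?(const _ (false, true)).
  - by rewrite (cardsD1 q K1) (cardsD1 q K2) q1 q2.
  - by move=> x; rewrite !inE => /andP[xq x2]; rewrite x2 on2.
  - by move=> x; rewrite !inE => /andP[xq x1]; rewrite x1 on1.
have [|phi phib phiE] := @recolor T _ (fun x => (x \in L1, x \in L2))
    (fun x => (x \in L1', x \in L2')).
  by rewrite (permPl (colors _ _ _ _ LS X)) c1 c2 perm_sym; apply: colors LS' X'.
exists phi => // A A3.
have m1 x : (phi x \in L1') = (x \in L1) by case: (phiE x).
have m2 x : (phi x \in L2') = (x \in L2) by case: (phiE x).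
have [[L1s L2s _] _] := X; have [[L1s' L2s' _] _] := X'.
split=> -[L LLs AL].
  have lL : long Ls L by rewrite /long LLs (leq_trans A3) // subset_leq_card.
  case: (crossing_long LS X lL) => E; [exists L1' | exists L2'] => //;
  by apply/subsetP=> _ /imsetP[x xA ->]; rewrite ?m1 ?m2 -E (subsetP AL).
have lL : long Ls' L.
  rewrite /long LLs (leq_trans A3) // -(card_imset _ (bij_inj phib)).
  exact: subset_leq_card.
case: (crossing_long LS' X' lL) => E; [exists L1 | exists L2] => //;
by apply/subsetP=> x xA; rewrite -?m1 -?m2 -E (subsetP AL) ?imset_f.
Qed.

Lemma degenerate_crossing (T : finType) (Ls : {set {set T}}) b x :
  linear_space Ls -> [set~ b] \in Ls -> x != b -> exists L, crossing Ls x [set~ b] L.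
Proof.
move=> LS bLs xb; have [L [LLs xL bL]] := line_through LS xb.
exists L; split; split; rewrite ?inE //.
  by apply/eqP=> E; move: bL; rewrite -E !inE eqxx.
by apply/setP=> z; rewrite !inE; case: eqP => // ->; rewrite bL.
Qed.

Lemma degenerate_points (T : finType) (Ls : {set {set T}}) b x :
  linear_space Ls -> [set~ b] \in Ls -> x != b -> hidden Ls x.
Proof.
move=> LS bLs /(degenerate_crossing LS bLs)[L X].
by apply/hiddenP; exists [set~ b], L.
Qed.

(** * Transfer of hidden points between two planes *)

Section TwoPlanes.
Variables (T : finType) (V : zmodType) (P : V -> Prop) (e e' : T -> V).
Variables Ls Ls' : {set {set T}}.
Hypotheses (PL : plane P e Ls) (PL' : plane P e' Ls').
Let LS : linear_space Ls := plane_lines PL.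
Let LS' : linear_space Ls' := plane_lines PL'.
Local Notation u := (flat_vec e).
Local Notation u' := (flat_vec e').

(** A hidden point of [Ls] makes the common graph complete bipartite, with colouring [s]. If [Ls']
    had none, all its points and long lines would be irreducible, and the colouring would fail on
    them. *)
Lemma hidden_transfer p : hidden Ls p -> exists p', hidden Ls' p'.
Proof.
case/hiddenP=> L1 [L2 X].
apply/existsP; apply: contraT => /existsPn nh.
have ND' : ~~ degenerate Ls'.
  apply/existsP=> -[b bLs]; have [x /andP[xb _]] := third_point LS' b b.
  by case/negP: (nh x); apply: degenerate_points bLs xb.
have ie x : irreducible P (e' x) by apply: (irreducible_point PL' ND').
have iu L : long Ls' L -> irreducible P (u' L) by apply: (irreducible_line PL' ND').
pose s v := v \in side e p L1 L2.
have adjE v w : irreducible P v -> irreducible P w -> adjacent P v w <-> s v != s w.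
  by move=> iv iw; apply: (adjacent_side PL X).
have nadj v w : irreducible P v -> irreducible P w -> ~ adjacent P v w -> s v = s w.
  by move=> iv iw h; apply/eqP; apply/negPn/negP=> /(adjE _ _ iv iw).
(* Without long lines any three points are pairwise adjacent, which two colours do not allow. *)
case: (pickP (long Ls')) => [L lL | noL]; last first.
  have adj x y : x != y -> s (e' x) != s (e' y).
    move=> xy; apply/(adjE _ _ (ie x) (ie y))/(adjacent_points PL' xy).
    by case: (long_or_short LS' xy) => // -[L [lL _ _]]; have := noL L; rewrite lL.
  have /card_gt2P[x [y [z [_ [xy yz zx]]]]] := points_gt2 LS'.
  have := adj _ _ xy; have := adj _ _ yz; have := adj _ _ zx.
  by case: (s (e' x)); case: (s (e' y)); case: (s (e' z)).
(* Non-adjacent vectors share their colour, so the points off [L] are coloured like [u' L]. Two of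
   them on a two-point line would be adjacent; on a long line [K] they clash with [u' K], which is
   not adjacent to [u' L] and so has the same colour. *)
have [LLs _] := andP lL.
have off x : x \notin L -> s (e' x) = s (u' L).
  move=> xL; apply: nadj => //; first exact: iu.
  by move/(adjacent_point_line PL' _ LLs); apply/negP.
have [x [y [xL yL xy]]] : exists x y, [/\ x \notin L, y \notin L & x != y].
  have [x xL] := line_neqT LS' LLs; have [y yx yL] := uncovered PL' ND' x LLs.
  by exists x, y; rewrite eq_sym.
have [S|[K [lK xK yK]]] := long_or_short LS' xy.
  by have := (adjacent_points PL' xy).2 S; move/(adjE _ _ (ie x) (ie y)); rewrite !off ?eqxx.
have [KLs _] := andP lK.
have sK : s (u' K) = s (u' L).
  apply: nadj; [exact: iu | exact: iu | ].
  case/(adjacent_lines PL' KLs LLs) => q [KL qK qL KLT].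
  by case/negP: (nh q); apply/hiddenP; exists K, L.
have := (adjacent_point_line PL' x KLs).2 xK.
by move/(adjE _ _ (ie x) (iu _ lK)); rewrite sK off ?eqxx.
Qed.

(** The only possible irreducible vectors of a degenerate plane are [e b] and the vector of the
    complement of [b], which are not adjacent; a nondegenerate plane with a hidden point has the
    adjacent irreducible pair [u' L1], [u' L2]. *)
Lemma degenerate_transfer : degenerate Ls -> degenerate Ls'.
Proof.
case/existsP=> b bLs; apply: contraT => ND'.
have [x /andP[xb _]] := third_point LS b b.
have [p' /hiddenP[L1 [L2 X]]] := hidden_transfer (degenerate_points LS bLs xb).
have i1 : irreducible P (u' L1).
  by apply: (side_irreducible PL' ND' X); apply/sideP; left.
have i2 : irreducible P (u' L2).
  by apply: (side_irreducible PL' ND' (crossingC X)); apply/sideP; left.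
have irr v : irreducible P v -> v = e b \/ v = u [set~ b].
  case/(irreducible_cases PL) => [[i hi ->]|[L lL ->]].
    by left; congr e; apply/eqP; apply: contraNT hi; apply: degenerate_points.
  right; congr (u _); apply/eqP; apply: contraT => n.
  have [LLs L3] := andP lL; move: L3; rewrite ltnNge (cardsD1 b).
  have := card_meet LS LLs bLs n; rewrite -setDE; case: (b \in L) => /=; lia.
have : adjacent P (u' L1) (u' L2).
  by apply: (side_adjacent PL' X); apply/sideP; left.
have nb : ~ adjacent P (e b) (u [set~ b]).
  by move/(adjacent_point_line PL _ bLs); rewrite !inE eqxx.
case: (irr _ i1) => ->; case: (irr _ i2) => ->.
- by case=> /eqP.
- by move/nb.
- by move/adjacentC/nb.
- by case=> /eqP.
Qed.

(** The part containing an irreducible vector consists of the irreducible vectors not adjacent to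
    it, so a common vector makes the two sides equal. *)
Lemma crossing_same_card p p' L1 L2 L1' L2' :
  ~~ degenerate Ls -> ~~ degenerate Ls' ->
  crossing Ls p L1 L2 -> crossing Ls' p' L1' L2' ->
  u L1 \in side e' p' L1' L2' -> #|L2| = #|L2'|.
Proof.
move=> ND ND' X X' v0.
have iv0 : irreducible P (u L1).
  by apply: (side_irreducible PL ND X); apply/sideP; left.
have v0s : u L1 \in side e p L1 L2 by apply/sideP; left.
rewrite -(side_size e X) -(side_size e' X'); apply/perm_size.
apply: uniq_perm; rewrite ?(side_uniq PL X) ?(side_uniq PL' X') //.
have E w : irreducible P w -> (w \in side e p L1 L2) = (w \in side e' p' L1' L2').
  move=> iw; have := adjacent_side PL X iv0 iw; have := adjacent_side PL' X' iv0 iw.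
  rewrite v0 v0s; case: (w \in side e p L1 L2); case: (w \in side e' p' L1' L2') => //= a b.
    by have /b.1 := a.2 isT.
  by have /a.1 := b.2 isT.
move=> w; apply/idP/idP=> ws.
  by rewrite -E //; apply: (side_irreducible PL ND X).
by rewrite E //; apply: (side_irreducible PL' ND' X').
Qed.

End TwoPlanes.

Lemma hidden_planes_isomorphic (T : finType) (V : zmodType) (P : V -> Prop)
    (e e' : T -> V) (Ls Ls' : {set {set T}}) p :
  plane P e Ls -> plane P e' Ls' -> hidden Ls p ->
  exists2 phi : T -> T, bijective phi & preserves_lines Ls Ls' phi.
Proof.
move=> PL PL' hp; have [p' hp'] := hidden_transfer PL PL' hp.
have [LS LS'] : linear_space Ls /\ linear_space Ls' by split; apply: plane_lines; eassumption.
case: (boolP (degenerate Ls)) => [D | ND].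
  have D' := degenerate_transfer PL PL' D.
  have big (Ks : {set {set T}}) (KS : linear_space Ks) : degenerate Ks ->
      exists q K1 K2, crossing Ks q K1 K2 /\ #|K1| = #|T|.-1.
    case/existsP=> b bKs; have [x /andP[xb _]] := third_point KS b b.
    have [K X] := degenerate_crossing KS bKs xb.
    by exists x, [set~ b], K; rewrite cardsC1.
  have [q [K1 [K2 [X c1]]]] := big _ LS D; have [q' [K1' [K2' [X' c1']]]] := big _ LS' D'.
  apply: (recolor_crossing LS LS' X X'); first by rewrite c1.
  by have := crossing_card LS X; have := crossing_card LS' X'; rewrite c1 c1'; lia.
have ND' : ~~ degenerate Ls'.
  by apply: contra ND; apply: degenerate_transfer PL' PL.
have /hiddenP[L1 [L2 X]] := hp; have /hiddenP[L1' [L2' X']] := hp'.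
have i1 : irreducible P (flat_vec e L1).
  by apply: (side_irreducible PL ND X); apply/sideP; left.
have := crossing_card LS X; have := crossing_card LS' X'.
have X2' := crossingC X'.
(* The vector of [L1] lies on one of the two sides of the second plane; if on the other one, [L1']
   and [L2'] exchange roles. *)
case: (crossing_irreducible PL' X' i1) => /(crossing_same_card PL PL' ND ND' X) c.
  have {}c := c X'; move=> c1 c2; apply: (recolor_crossing LS LS' X X') => //.
  by move: c1 c2; rewrite c; clear; lia.
have {}c := c X2'; move=> c1 c2; apply: (recolor_crossing LS LS' X X2') => //.
by move: c1 c2; rewrite c; clear; lia.
Qed.

(** * Fans without hidden points *)

Section Visible.
Variables (T : finType) (V : zmodType) (P : V -> Prop) (e : T -> V).
Variable Ls : {set {set T}}.
Hypothesis PL : plane P e Ls.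
Hypothesis visible : forall p, ~~ hidden Ls p.
Let LS : linear_space Ls := plane_lines PL.
Local Notation u := (flat_vec e).

Lemma visible_nondegenerate : ~~ degenerate Ls.
Proof.
apply/existsP=> -[b bLs]; have [x /andP[xb _]] := third_point LS b b.
by case/negP: (visible x); apply: degenerate_points bLs xb.
Qed.
Let ND := visible_nondegenerate.

Lemma visible_point x : irreducible P (e x).
Proof. exact: irreducible_point PL ND _ (visible x). Qed.

Lemma visible_line L : long Ls L -> irreducible P (u L).
Proof. exact: irreducible_line PL ND _. Qed.

Lemma visible_cases v : irreducible P v ->
  (exists x, v = e x) \/ (exists2 L, long Ls L & v = u L).
Proof. by case/(irreducible_cases PL) => [[x _ ->]|]; [left; exists x | right]. Qed.

Lemma visible_lines L L' : long Ls L -> long Ls L' -> ~ adjacent P (u L) (u L').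
Proof.
move=> /andP[LLs _] /andP[L's _] /(adjacent_lines PL LLs L's)[p [? ? ? ?]].
by case/negP: (visible p); apply/hiddenP; exists L, L'.
Qed.

Lemma sum_flat_vec (K : {set {set T}}) :
  \sum_(L in K) u L = wsum e (fun y => #|[set L in K | y \in L]|).
Proof.
rewrite (eq_bigr (fun L : {set T} => \sum_y e y *+ (y \in L))); last first.
  by move=> L _; rewrite flat_vecE.
rewrite exchange_big; apply: eq_bigr => y _ /=.
rewrite sumrMnr; congr (_ *+ _).
by rewrite -sum1dep_card big_mkcondr.
Qed.

Definition short_neighbors x := [set j | (j != x) && ([set x; j] \in Ls)].
Definition long_lines_at x := [set L | long Ls L && (x \in L)].

(** Explicit lists of irreducible neighbours, here and in [mem_line_neighbors], allow sums over
    neighbours to be compared between two planes. *)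
Lemma mem_point_neighbors x v :
  v \in [seq e j | j <- enum (short_neighbors x)] ++
        [seq u L | L <- enum (long_lines_at x)] <->
  irreducible P v /\ adjacent P (e x) v.
Proof.
rewrite mem_cat; split=> [/orP[]/mapP[z]|[iv axv]].
- rewrite mem_enum inE => /andP[zx xzLs] ->; split; first exact: visible_point.
  by apply/(adjacent_points PL) => //; rewrite eq_sym.
- rewrite mem_enum inE => /andP[lz xz] ->; split; first exact: visible_line.
  by apply/(adjacent_point_line PL) => //; case/andP: lz.
apply/orP; case: (visible_cases iv) => [[z vz]|[L lL vL]]; [left|right].
  apply/mapP; exists z => //; rewrite mem_enum inE.
  have xz : x != z by case: axv => n _ _; apply: contraNneq n => ->; rewrite vz.
  by rewrite eq_sym xz; apply/(adjacent_points PL xz); rewrite -vz.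
apply/mapP; exists L => //; rewrite mem_enum inE lL.
by apply/(adjacent_point_line PL); [case/andP: lL | rewrite -vL].
Qed.

Lemma uniq_point_neighbors x :
  uniq ([seq e j | j <- enum (short_neighbors x)] ++
        [seq u L | L <- enum (long_lines_at x)]).
Proof.
rewrite cat_uniq map_inj_in_uniq ?enum_uniq => [|i j _ _]; last exact: point_inj PL _ _.
rewrite map_inj_in_uniq ?enum_uniq ?andbT.
  apply/hasPn=> v /mapP[L]; rewrite mem_enum inE => /andP[/andP[LLs _] _] ->.
  by apply/mapP=> -[j _] /esym/eqP; apply/negP; apply: point_neq_line PL _ _ _.
move=> K L; rewrite !mem_enum !inE => /andP[/andP[Ks _] _] /andP[/andP[LLs _] _].
exact: line_vec_inj PL _ _ _ _.
Qed.

Lemma mem_line_neighbors L v : long Ls L ->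
  v \in [seq e y | y <- enum L] <-> irreducible P v /\ adjacent P v (u L).
Proof.
move=> lL; have [LLs _] := andP lL; split=> [/mapP[y]|[iv avL]].
  rewrite mem_enum => yL ->; split; first exact: visible_point.
  exact/(adjacent_point_line PL).
case: (visible_cases iv) => [[y vy]|[K lK vK]].
  apply/mapP; exists y => //; rewrite mem_enum.
  by apply/(adjacent_point_line PL y LLs); rewrite -vy.
by move: avL; rewrite vK => /(visible_lines lK lL).
Qed.

Lemma sum_point_neighbors x :
  \sum_(v <- [seq e j | j <- enum (short_neighbors x)] ++
             [seq u L | L <- enum (long_lines_at x)]) v =
  wsum e (fun y => (y \in short_neighbors x) +
                   #|[set L in long_lines_at x | y \in L]|)%N.
Proof.
rewrite big_cat !big_map !big_enum /= -wsumD -flat_vecE; congr (_ + _).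
exact: sum_flat_vec.
Qed.

(* The two-dimensional cones around a ray generated by e x are spanned by the
   neighbours of e x, whose sum is (k - 1) e x for k long lines through x, and
   k = 2 is what makes it look like the ray of a line. *)
Lemma two_long_lines x : 
  \sum_(v <- [seq e j | j <- enum (short_neighbors x)] ++
             [seq u L | L <- enum (long_lines_at x)]) v = e x ->
  #|long_lines_at x| = 2.
Proof.
have [y /andP[yx _]] := third_point LS x x; have xy : x != y by rewrite eq_sym.
(* At [x] the weight counts the long lines through [x]; at [y] it is 1, coming from the two-point
   line or from the unique long line joining [x] to [y]. For [e x] the two values differ by 1. *)
rewrite sum_point_neighbors [RHS](vecE e) => /(frameP PL)/(_ x y).
have -> : [set L in long_lines_at x | x \in L] = long_lines_at x.
  by apply/setP=> L; rewrite !inE -andbA andbb.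
rewrite [x \in _]inE eqxx (negPf yx) /= addn0 add0n => ->; rewrite addn1; congr _.+1.
rewrite inE yx /=; have [S|[L [lL xL yL]]] := long_or_short LS xy.
  rewrite S (_ : [set L in _ | _] = set0) ?cards0 //; apply/setP=> L; rewrite !inE.
  apply/negP=> /andP[/andP[lL xL] yL]; exact: (short_not_long LS xy S lL).
have -> : ([set x; y] \in Ls) = false.
  by apply/negP=> S; apply: (short_not_long LS xy S lL).
rewrite (_ : [set L in _ | _] = [set L]) ?cards1 //; apply/setP=> K; rewrite !inE.
apply/andP/eqP=> [[/andP[/andP[Ks _] xK] yK]|->]; last by rewrite lL xL yL.
by case/andP: lL => LLs _; apply: (line_uniq LS xy).
Qed.

End Visible.

(** * Points of one plane that are lines of the other *)

Section VisiblePlanes.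
Variables (T : finType) (V : zmodType) (P : V -> Prop) (e e' : T -> V).
Variables Ls Ls' : {set {set T}}.
Hypotheses (PL : plane P e Ls) (PL' : plane P e' Ls').
Hypotheses (vis : forall p, ~~ hidden Ls p) (vis' : forall p, ~~ hidden Ls' p).
Let LS : linear_space Ls := plane_lines PL.
Let LS' : linear_space Ls' := plane_lines PL'.
Local Notation u := (flat_vec e).
Local Notation u' := (flat_vec e').

Definition turned_points := [set x | [exists L, long Ls' L && (e x == u' L)]].
Definition turned_lines := [set L | long Ls L && [exists y, u L == e' y]].

Lemma turned_pointP x :
  reflect (exists2 L, long Ls' L & e x = u' L) (x \in turned_points).
Proof.
rewrite inE; apply: (iffP existsP) => [[L /andP[lL /eqP E]]|[L lL E]].
  by exists L.
by exists L; rewrite lL E eqxx.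
Qed.

Lemma turned_lineP L :
  reflect (long Ls L /\ exists y, u L = e' y) (L \in turned_lines).
Proof.
rewrite inE; apply: (iffP andP) => [[lL /existsP[y /eqP E]]|[lL [y E]]].
  by split=> //; exists y.
by split=> //; apply/existsP; exists y; rewrite E.
Qed.

Lemma unturned_point x : x \notin turned_points -> exists y, e x = e' y.
Proof.
move=> xX; case: (visible_cases PL' (visible_point PL vis x)) => [//|[L lL E]].
by case/turned_pointP: xX; exists L.
Qed.

Lemma unturned_line L : long Ls L -> L \notin turned_lines ->
  exists2 L', long Ls' L' & u L = u' L'.
Proof.
move=> lL LB; case: (visible_cases PL' (visible_line PL vis lL)) => [[y E]|//].
by case/turned_lineP: LB; split=> //; exists y.
Qed.

(** If [L] kept a line vector, two line vectors of [Ls'] would be adjacent. *)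
Lemma turned_through x L : x \in turned_points -> long Ls L -> x \in L ->
  L \in turned_lines.
Proof.
case/turned_pointP=> L' lL' E lL xL; apply/negPn/negP=> /(unturned_line lL)[K lK uK].
have [LLs _] := andP lL.
have := (adjacent_point_line PL x LLs).2 xL; rewrite E uK.
exact: visible_lines PL' vis' _ _ lL' lK.
Qed.

(** On a two-point line [x] and [y] would be adjacent, but both are line vectors of [Ls']. *)
Lemma turned_joined x y : x \in turned_points -> y \in turned_points -> x != y ->
  exists L, [/\ L \in turned_lines, x \in L & y \in L].
Proof.
move=> xX yX xy; have [S|[L [lL xL yL]]] := long_or_short LS xy; last first.
  by exists L; split=> //; apply: turned_through xX lL xL.
have := (adjacent_points PL xy).2 S.
case/turned_pointP: xX => K lK ->; case/turned_pointP: yX => K' lK' ->.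
by move/(visible_lines PL' vis' lK lK').
Qed.

(** Seen as [u' L'], the vector has as neighbours the [e' y] with [y] in [L'], whose sum is the
    vector itself, as [two_long_lines] requires. *)
Lemma turned_point_lines x : x \in turned_points -> #|long_lines_at Ls x| = 2.
Proof.
case/turned_pointP=> L' lL' E; apply: (two_long_lines PL).
transitivity (\sum_(v <- [seq e' y | y <- enum L']) v); last first.
  by rewrite E big_map big_enum.
apply/perm_big/uniq_perm.
- exact: uniq_point_neighbors PL _.
- by rewrite map_inj_uniq ?enum_uniq // => i j; apply: point_inj PL' _ _.
move=> v; apply/idP/idP.
  move/(mem_point_neighbors PL vis) => [iv av].
  by apply/(mem_line_neighbors PL' vis' v lL'); rewrite -E; split=> //; apply: adjacentC.
move/(mem_line_neighbors PL' vis' v lL'); rewrite -E => -[iv av].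
by apply/(mem_point_neighbors PL vis); split=> //; apply: adjacentC.
Qed.
End VisiblePlanes.

(** * The triangle of turned points and its Cremona transformation *)

Section VisibleIsomorphism.
Variables (T : finType) (V : zmodType) (P : V -> Prop) (e e' : T -> V).
Variables Ls Ls' : {set {set T}}.
Hypotheses (PL : plane P e Ls) (PL' : plane P e' Ls').
Hypotheses (vis : forall p, ~~ hidden Ls p) (vis' : forall p, ~~ hidden Ls' p).
Let LS : linear_space Ls := plane_lines PL.
Let LS' : linear_space Ls' := plane_lines PL'.
Local Notation u := (flat_vec e).
Local Notation u' := (flat_vec e').
Local Notation X := (turned_points e e' Ls').
Local Notation B := (turned_lines e e' Ls).

(** The dual count: if [u L = e' y], the two long lines of [Ls'] through [y] have the same vectors
    as the points of [L] in [X]. *)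
Lemma turned_line_points L : L \in B -> #|L :&: X| = 2.
Proof.
case/turned_lineP=> lL [y E]; have [LLs _] := andP lL.
have yX : y \in turned_points e' e Ls by apply/turned_pointP; exists L.
rewrite -(turned_point_lines PL' PL vis' vis yX) !cardE.
rewrite -(size_map e) -(size_map u'); apply/perm_size/uniq_perm.
- by rewrite map_inj_uniq ?enum_uniq // => i j; apply: point_inj PL _ _.
- rewrite map_inj_in_uniq ?enum_uniq // => K K'.
  rewrite !mem_enum !inE => /andP[/andP[Ks _] _] /andP[/andP[Ks' _] _].
  exact: line_vec_inj PL' _ _ _ _.
move=> v; apply/mapP/mapP=> -[z]; rewrite mem_enum.
  rewrite in_setI => /andP[zL /turned_pointP[K lK zK]] ->; exists K => //.
  rewrite mem_enum inE lK; apply/(adjacent_point_line PL'); first by case/andP: lK.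
  by rewrite -zK -E; apply/adjacentC/(adjacent_point_line PL).
rewrite inE => /andP[lz yz] ->; have [zLs _] := andP lz.
have a := (adjacent_point_line PL' y zLs).2 yz; rewrite -E in a.
case: (visible_cases PL (visible_line PL' vis' lz)) => [[x xE]|[K lK uK]]; last first.
  by move: a; rewrite uK => /(visible_lines PL vis lL lK).
exists x => //; rewrite mem_enum in_setI; apply/andP; split.
  by apply/(adjacent_point_line PL x LLs)/adjacentC; rewrite -xE.
by apply/turned_pointP; exists z.
Qed.

(** Each of the two long lines through [x] carries exactly one more point of [X], and
    [turned_joined] puts every other point of [X] on one of them. *)
Lemma turned_card x : x \in X -> #|X| = 3.
Proof.
move=> xX; have /eqP/cards2P[L [M [LM E]]] := turned_point_lines PL PL' vis vis' xX.
have at_x K : K \in long_lines_at Ls x -> K \in B /\ x \in K.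
  by rewrite inE => /andP[lK xK]; split=> //; apply: (turned_through PL PL' vis vis' xX lK xK).
have other K : K \in B -> x \in K -> exists2 y, y != x & K :&: X = [set x; y].
  move=> KB xK; have c := turned_line_points KB.
  have xKX : x \in K :&: X by rewrite in_setI xK.
  have /eqP/cards1P[y Ey] : #|(K :&: X) :\ x| = 1 by move: c; rewrite (cardsD1 x) xKX => -[].
  exists y; first by have := set11 y; rewrite -Ey in_setD1 => /andP[].
  by rewrite -(setD1K xKX) Ey.
have [LB xL] : L \in B /\ x \in L by apply: at_x; rewrite E !inE eqxx.
have [MB xM] : M \in B /\ x \in M by apply: at_x; rewrite E !inE eqxx orbT.
have [y yx Ey] := other _ LB xL; have [z zx Ez] := other _ MB xM.
have [yL yX] : y \in L /\ y \in X.
  by apply/andP; rewrite -in_setI Ey !inE eqxx orbT.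
have [zM zX] : z \in M /\ z \in X.
  by apply/andP; rewrite -in_setI Ez !inE eqxx orbT.
have [lL _] := turned_lineP _ _ _ _ LB; have [lM _] := turned_lineP _ _ _ _ MB.
have yz : y != z.
  apply: contraNneq LM => yz; apply/eqP; case/andP: lL => LLs _; case/andP: lM => Ms _.
  by apply: (line_uniq LS yx) => //; rewrite yz.
suff -> : X = [set x; y; z].
  by rewrite setUC cardsU1 cards2 !inE negb_or zx eq_sym yz eq_sym yx.
apply/setP=> w; rewrite !in_setU !in_set1; apply/idP/orP; last first.
  by case=> [/orP[]|] /eqP->.
move=> wX; have [->|wx] := eqVneq w x; first by left.
have [K [KB wK xK]] := turned_joined PL PL' vis vis' wX xX wx.
have [lK _] := turned_lineP _ _ _ _ KB.
have : K \in [set L; M] by rewrite -E inE lK.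
rewrite !inE => /orP[/eqP KE|/eqP KE]; [left | right].
  by have : w \in L :&: X; [rewrite in_setI -KE wK | rewrite Ey !inE (negPf wx)].
by have : w \in M :&: X; [rewrite in_setI -KE wK | rewrite Ez !inE (negPf wx)].
Qed.

Lemma turned_missing L x : L \in B -> x \in X -> x \notin L -> L :&: X = X :\ x.
Proof.
move=> LB xX xL; apply/eqP; rewrite eqEcard; apply/andP; split.
  by apply/subsetP=> y; rewrite !in_setI in_setD1 => /andP[yL ->]; rewrite andbT;
    apply: contraNneq xL => <-.
rewrite (turned_line_points LB); have := turned_card xX.
by rewrite (cardsD1 x) xX add1n => -[->].
Qed.

Lemma turned_missing_point L x y : L \in B -> x \in X -> y \in X ->
  x \notin L -> (y \in L) = (y != x).
Proof.
move=> LB xX yX xL; have /setP/(_ y) := turned_missing LB xX xL.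
by rewrite in_setI in_setD1 yX !andbT.
Qed.

Lemma turned_missing_uniq L M x : L \in B -> M \in B -> x \in X ->
  x \notin L -> x \notin M -> L = M.
Proof.
move=> LB MB xX xL xM.
have E : L :&: X = M :&: X by rewrite (turned_missing LB xX xL) (turned_missing MB xX xM).
have /eqP/cards2P[y [z [yz yzE]]] := turned_line_points LB.
have [lL _] := turned_lineP _ _ _ _ LB; have [lM _] := turned_lineP _ _ _ _ MB.
have y1 : y \in L :&: X by rewrite yzE !inE eqxx.
have z1 : z \in L :&: X by rewrite yzE !inE eqxx orbT.
have y2 := y1; have z2 := z1; rewrite E in y2 z2.
move: y1 z1 y2 z2; rewrite !in_setI => /andP[yL _] /andP[zL _] /andP[yM _] /andP[zM _].
by case/andP: lL => LLs _; case/andP: lM => Ms _; apply: (line_uniq LS yz).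
Qed.

(** The side joining the other two vertices cannot pass through [x], since it contains only two
    points of [X]. *)
Lemma turned_opposite x : x \in X -> exists2 L, L \in B & x \notin L.
Proof.
move=> xX; have := turned_card xX; rewrite (cardsD1 x) xX add1n => -[/eqP/cards2P[y [z [yz E]]]].
have : y \in X :\ x by rewrite E !inE eqxx.
have : z \in X :\ x by rewrite E !inE eqxx orbT.
rewrite !in_setD1 => /andP[zx zX] /andP[yx yX].
have [L [LB yL zL]] := turned_joined PL PL' vis vis' yX zX yz.
exists L => //; apply/negP=> xL.
have /subset_leq_card : X \subset L :&: X.
  apply/subsetP=> w wX; rewrite in_setI wX andbT; have [->//|wx] := eqVneq w x.
  have : w \in X :\ x by rewrite in_setD1 wx.
  by rewrite E !inE => /orP[]/eqP->.
by rewrite (turned_line_points LB) (turned_card xX).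
Qed.

Lemma turned_line_misses L : L \in B -> exists2 x, x \in X & x \notin L.
Proof.
move=> LB; have c := turned_line_points LB.
have /card_gt0P[x] : (0 < #|L :&: X|)%N by rewrite c.
rewrite in_setI => /andP[_ xX]; have c3 := turned_card xX.
have : (0 < #|X :\: L|)%N by rewrite -(ltn_add2l #|X :&: L|) cardsID addn0 setIC c c3.
by case/card_gt0P=> y; rewrite in_setD => /andP[yL yX]; exists y.
Qed.

(* The vectors e' y, which sum to 0, are the e w with w in ~: X and the
   u L with L in B. *)
Lemma turned_line_through x w : x \in X -> w \notin X ->
  #|[set L in B | w \in L]| = 1.
Proof.
move=> xX wX.
have : \sum_(v <- [seq e z | z <- enum (~: X)] ++ [seq u L | L <- enum B]) v = 0.
  transitivity (\sum_(v <- [seq e' y | y <- enum [set: T]]) v); last first.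
    by rewrite big_map big_enum; apply: total_vec PL'.
  apply/perm_big/uniq_perm.
  - rewrite cat_uniq map_inj_uniq ?enum_uniq => [|i j]; last exact: point_inj PL _ _.
    rewrite map_inj_in_uniq ?enum_uniq ?andbT.
      apply/hasPn=> v /mapP[L]; rewrite mem_enum => /turned_lineP[/andP[LLs _] _] ->.
      by apply/mapP=> -[j _] /esym/eqP; apply/negP; apply: point_neq_line PL _ _ _.
    move=> K L; rewrite !mem_enum => /turned_lineP[/andP[Ks _] _] /turned_lineP[/andP[LLs _] _].
    exact: line_vec_inj PL _ _ _ _.
  - rewrite map_inj_uniq ?enum_uniq // => i j; exact: point_inj PL' _ _.
  move=> v; rewrite mem_cat; apply/orP/mapP=> [[]/mapP[z]|[y _ ->]].
  - rewrite mem_enum in_setC => /(unturned_point PL PL' vis)[y zy] ->.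
    by exists y; rewrite ?mem_enum ?in_setT.
  - rewrite mem_enum => /turned_lineP[_ [y zy]] ->.
    by exists y; rewrite ?mem_enum ?in_setT.
  case: (visible_cases PL (visible_point PL' vis' y)) => [[z E]|[L lL E]]; [left|right].
    apply/mapP; exists z => //; rewrite mem_enum in_setC; apply/turned_pointP=> -[K lK zK].
    by have /eqP := point_neq_line PL' y (proj1 (andP lK)); rewrite E.
  by apply/mapP; exists L => //; rewrite mem_enum; apply/turned_lineP; split=> //; exists y.
rewrite big_cat !big_map !big_enum /= sum_flat_vec.
have -> : \sum_(z in ~: X) e z = wsum e (fun z => z \in ~: X) by rewrite -flat_vecE.
rewrite wsumD => /(wsum_eq0 PL)/(_ w x).
(* Constancy of the weight equates one plus the number of sides through [w] with the number of sides
   through the vertex [x], which is 2. *)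
rewrite !in_setC xX wX add0n add1n.
have -> : [set L in B | x \in L] = long_lines_at Ls x.
  apply/setP=> L; rewrite !in_set; apply/andP/andP=> -[].
    by case/andP.
  by move=> lL xL; have := turned_through PL PL' vis vis' xX lL xL; rewrite inE.
by rewrite (turned_point_lines PL PL' vis vis' xX) => -[].
Qed.

(** Exactly one side [Q] passes through [w]. If it is the side opposite [x], a long line through [w]
    and [x] would be a second one; if [w] and [x] form a two-point line, [Q] avoids [x] and so is
    [L]. *)
Lemma turned_line_off x w L : x \in X -> w \notin X -> L \in B -> x \notin L ->
  w \in L <-> [set w; x] \in Ls.
Proof.
move=> xX wX LB xL; have wx : w != x by apply: contraNneq wX => ->.
have /eqP/cards1P[Q QE] := turned_line_through xX wX.
have uniqB K : K \in B -> w \in K -> K = Q.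
  by move=> KB wK; apply/set1P; rewrite -QE inE KB.
split=> [wL|S].
  have [//|[K [lK wK xK]]] := long_or_short LS wx.
  have KB := turned_through PL PL' vis vis' xX lK xK.
  by case/negP: xL; rewrite (uniqB L LB wL) -(uniqB K KB wK).
have : Q \in [set Q] by rewrite inE.
rewrite -QE inE => /andP[QB wQ]; have [lQ _] := turned_lineP _ _ _ _ QB.
rewrite (turned_missing_uniq LB QB xX xL) //.
by apply/negP=> xQ; apply: (short_not_long LS wx S lQ).
Qed.

(* Quadratic Cremona transformation: an element of X is sent to the line of B
   not containing it. *)
Definition cremona_image w y : Prop :=
  (w \notin X /\ e w = e' y) \/
  (w \in X /\ exists L, [/\ L \in B, w \notin L & u L = e' y]).

Lemma cremona_image_inj w w' y : cremona_image w y -> cremona_image w' y -> w = w'.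
Proof.
have mixed z z' K : K \in B -> e z = e' z' -> u K = e' z' -> False.
  case/turned_lineP=> /andP[Ks _] _ <- /esym/eqP.
  by apply/negP; apply: point_neq_line PL _ _ _.
case=> [[wX E]|[wX [L [LB wL E]]]] [[wX' E']|[wX' [L' [LB' wL' E']]]].
- by apply: (point_inj PL); rewrite E E'.
- by case: (mixed _ _ _ LB' E E').
- by case: (mixed _ _ _ LB E' E).
have LL' : L = L'.
  have [/andP[Ls1 _] _] := turned_lineP _ _ _ _ LB.
  have [/andP[Ls2 _] _] := turned_lineP _ _ _ _ LB'.
  by apply: (line_vec_inj PL Ls1 Ls2); rewrite E E'.
apply/eqP; have := turned_missing_point LB wX wX' wL.
by rewrite LL' (negPf wL') eq_sym => /esym/negbFE.
Qed.

Lemma cremona_image_exists w : exists y, cremona_image w y.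
Proof.
case: (boolP (w \in X)) => wX; last first.
  by have [y wy] := unturned_point PL PL' vis wX; exists y; left.
have [L LB wL] := turned_opposite wX.
by have [_ [y Ly]] := turned_lineP _ _ _ _ LB; exists y; right; split=> //; exists L.
Qed.

(** The companion relation on long lines: a side goes to the line whose vector is that of the
    opposite vertex, any other line keeps its vector. *)
Definition cremona_line (L L' : {set T}) : Prop :=
  [/\ long Ls L, L \notin B & u L = u' L'] \/
  (L \in B /\ exists x, [/\ x \in X, x \notin L & e x = u' L']).

(** Incidence is adjacency, which depends on [P] alone, so it can be translated from [Ls'] to [Ls]
    in each of the four cases. *)
Lemma cremona_incidence w y L L' : long Ls' L' -> cremona_image w y ->
  cremona_line L L' -> (y \in L') = (w \in L).
Proof.
move=> lL'; have [Ls'L' _] := andP lL'.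
have inc : y \in L' <-> adjacent P (e' y) (u' L').
  by rewrite (adjacent_point_line PL' y Ls'L').
move=> wy LL'; suff : y \in L' <-> w \in L.
  by case: (y \in L'); case: (w \in L) => // -[a b]; [have := a isT | have := b isT].
rewrite inc; case: LL' => [[lL LB <-]|[LB [x [xX xL <-]]]].
  have [LLs _] := andP lL.
  case: wy => [[wX <-]|[wX [Q [QB wQ <-]]]]; first exact: (adjacent_point_line PL w LLs).
  (* Both sides are false: line vectors are never adjacent, and long lines through a vertex are
     turned. *)
  have [lQ _] := turned_lineP _ _ _ _ QB.
  split=> [/(visible_lines PL vis lQ lL) //|wL].
  by case/negP: LB; apply: (turned_through PL PL' vis vis' wX lL wL).
case: wy => [[wX <-]|[wX [Q [QB wQ <-]]]].
  rewrite (turned_line_off xX wX LB xL); apply: (adjacent_points PL).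
  by apply: contraNneq wX => ->.
(* Both sides say that the vertices [x] and [w] differ. *)
have [/andP[QLs _] _] := turned_lineP _ _ _ _ QB.
rewrite (turned_missing_point LB xX wX xL) eq_sym.
rewrite -(turned_missing_point QB wX xX wQ) -(adjacent_point_line PL x QLs).
by split; apply: adjacentC.
Qed.

Lemma cremona_line_right L : long Ls L -> exists2 L', long Ls' L' & cremona_line L L'.
Proof.
move=> lL; case: (boolP (L \in B)) => LB.
  have [x xX xL] := turned_line_misses LB; have [K lK xK] := turned_pointP _ _ _ _ xX.
  by exists K => //; right; split=> //; exists x.
by have [K lK LK] := unturned_line PL PL' vis lL LB; exists K => //; left.
Qed.

Lemma cremona_line_left L' : long Ls' L' -> exists2 L, long Ls L & cremona_line L L'.
Proof.
move=> lL'; case: (visible_cases PL (visible_line PL' vis' lL')) => [[x E]|[L lL E]].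
  have xX : x \in X by apply/turned_pointP; exists L'.
  have [L LB xL] := turned_opposite xX; have [lL _] := turned_lineP _ _ _ _ LB.
  by exists L => //; right; split=> //; exists x.
exists L => //; left; split=> //; apply/turned_lineP=> -[_ [y Ly]].
have [Ls'L' _] := andP lL'.
by have /eqP := point_neq_line PL' y Ls'L'; rewrite E Ly.
Qed.

Lemma visible_planes_isomorphic :
  exists2 phi : T -> T, bijective phi & preserves_lines Ls Ls' phi.
Proof.
have [phi phiE] := fin_all_exists cremona_image_exists.
have inj_phi : injective phi.
  move=> w w' ww'; apply: (cremona_image_inj (phiE w)).
  by rewrite ww'; apply: phiE.
exists phi; first exact: injF_bij.
move=> A A3; split=> -[L LLs AL].
  have lL : long Ls L by rewrite /long LLs (leq_trans A3) // subset_leq_card.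
  have [L' lL' LL'] := cremona_line_right lL; exists L'; first by case/andP: lL'.
  apply/subsetP=> _ /imsetP[w wA ->].
  by rewrite (cremona_incidence lL' (phiE w) LL') (subsetP AL).
have lL : long Ls' L.
  by rewrite /long LLs (leq_trans A3) // -(card_imset _ inj_phi) subset_leq_card.
have [L0 lL0 LL0] := cremona_line_left lL; exists L0; first by case/andP: lL0.
apply/subsetP=> w wA; rewrite -(cremona_incidence lL (phiE w) LL0) (subsetP AL) //.
exact: imset_f.
Qed.

End VisibleIsomorphism.

Lemma planes_isomorphic (T : finType) (V : zmodType) (P : V -> Prop)
    (e e' : T -> V) (Ls Ls' : {set {set T}}) :
  plane P e Ls -> plane P e' Ls' ->
  exists2 phi : T -> T, bijective phi & preserves_lines Ls Ls' phi.
Proof.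
move=> PL PL'; case: (pickP (hidden Ls)) => [p hp|vis].
  exact: hidden_planes_isomorphic PL PL' hp.
apply: (visible_planes_isomorphic PL PL') => p; first by rewrite vis.
apply/negP=> /(hidden_transfer PL' PL)[q]; by rewrite vis.
Qed.

(** * Matroids and their Bergman fans *)

Section Matroid.
Variables (T : finType) (M : matroid T).
Hypotheses (simple : simple_matroid M) (rank3 : mrank M [set: T] = 3%N).

Definition lines : {set {set T}} :=
  [set F : {set T} | [&& [forall x, (x \notin F) ==> (mrank M F < mrank M (x |: F))%N],
            (1 < #|F|)%N & F != setT]].

Lemma linesP (F : {set T}) :
  reflect [/\ is_flat M F, (1 < #|F|)%N & F != setT] (F \in lines).
Proof.
rewrite inE; apply: (iffP and3P) => -[flatF F1 FT]; split=> //.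
  by move=> x xF; have := forallP flatF x; rewrite xF.
by apply/forallP=> x; apply/implyP=> xF; apply: flatF.
Qed.

Lemma indep_le_rank (I A : {set T}) : I \in indep M -> I \subset A -> (#|I| <= mrank M A)%N.
Proof. by move=> iI IA; apply: (bigmax_sup I); rewrite // iI. Qed.

Lemma rank_leP (A : {set T}) k :
  reflect (forall I : {set T}, I \in indep M -> I \subset A -> (#|I| <= k)%N)
          (mrank M A <= k)%N.
Proof.
apply: (iffP (bigmax_leqP _ _ _)) => h I; first by move=> iI IA; apply: h; rewrite iI.
by case/andP; apply: h.
Qed.

Lemma rank_ltP (A : {set T}) k : (k < mrank M A)%N ->
  exists I : {set T}, [/\ I \in indep M, I \subset A & (k < #|I|)%N].
Proof.
move=> kA; case: (boolP [exists I in indep M, (I \subset A) && (k < #|I|)%N]).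
  by case/exists_inP=> I iI /andP[]; exists I.
move/exists_inPn=> h; move: kA; rewrite ltnNge; case/negP; apply/rank_leP=> I iI IA.
by have := h I iI; rewrite IA -leqNgt.
Qed.

Lemma rankS (A B : {set T}) : A \subset B -> (mrank M A <= mrank M B)%N.
Proof.
by move=> AB; apply/rank_leP=> I iI IA; apply: indep_le_rank iI (subset_trans IA AB).
Qed.

Lemma rank_le3 (A : {set T}) : (mrank M A <= 3)%N.
Proof. by rewrite -rank3 rankS ?subsetT. Qed.

Lemma indep_le2 (A : {set T}) : (#|A| <= 2)%N -> A \in indep M.
Proof.
case: simple => noloop nopar; case: (ltngtP #|A| 1%N) => [|A1 A2|/eqP/cards1P[x ->] _].
- by rewrite ltnS leqn0 => /eqP/cards0_eq -> _; apply: indep0.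
- have /eqP/cards2P[x [y [xy ->]]] : #|A| = 2%N by apply/eqP; rewrite eqn_leq A2.
  by apply/negPn/negP=> xyI; apply: (nopar x y); split.
by apply/negPn/negP; apply: noloop.
Qed.

Lemma rank_pair x y (A : {set T}) : x != y -> x \in A -> y \in A -> (1 < mrank M A)%N.
Proof.
move=> xy xA yA; have := @indep_le_rank [set x; y] A; rewrite cards2 xy; apply.
  by apply: indep_le2; rewrite cards2 xy.
by rewrite subUset !sub1set xA.
Qed.

Lemma augment_pair x y (I : {set T}) : x != y -> I \in indep M -> (2 < #|I|)%N ->
  exists z, [/\ z \in I, z != x, z != y & z |: [set x; y] \in indep M].
Proof.
move=> xy iI I3.
have [||z] := @indep_augment _ M [set x; y] I _ iI _; rewrite ?cards2 ?xy //.
  by apply: indep_le2; rewrite cards2 xy.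
by rewrite !inE negb_or => /andP[/andP[zx zy] zI] zxy; exists z.
Qed.

Lemma card_triple (x y z : T) : x != y -> z != x -> z != y -> #|z |: [set x; y]| = 3%N.
Proof. by move=> xy zx zy; rewrite cardsU1 cards2 !inE negb_or zx zy xy. Qed.

(** The closure of a pair. Its two points are listed separately because for them the third clause is
    about the pair itself, which is independent. *)
Definition span x y := [set z | [|| z == x, z == y | z |: [set x; y] \notin indep M]].

Lemma rank_span x y : x != y -> (mrank M (span x y) <= 2)%N.
Proof.
move=> xy; apply/rank_leP=> I iI /subsetP Is; rewrite leqNgt; apply/negP=> I3.
have [z [/Is zI zx zy zxy]] := augment_pair xy iI I3.
by move: zI; rewrite !inE (negPf zx) (negPf zy) zxy.
Qed.

Lemma span_line x y : x != y -> span x y \in lines.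
Proof.
move=> xy; have [xs ys] : x \in span x y /\ y \in span x y by rewrite !inE !eqxx orbT.
apply/linesP; split.
- move=> z; rewrite !inE !negb_or negbK => /and3P[zx zy zxy].
  apply: leq_ltn_trans (rank_span xy) _; rewrite -(card_triple xy zx zy).
  by apply: indep_le_rank; rewrite // setUS // subUset !sub1set xs.
- have : (#|[set x; y]| <= #|span x y|)%N by apply: subset_leq_card; rewrite subUset !sub1set xs.
  by rewrite cards2 xy.
by apply: contraTneq (rank_span xy) => ->; rewrite rank3.
Qed.

Lemma line_rank L : L \in lines -> (mrank M L <= 2)%N.
Proof.
case/linesP=> flatL _ /neq_setTP[z zL]; rewrite -ltnS.
exact: leq_trans (flatL z zL) (rank_le3 _).
Qed.

Lemma line_span L x y : L \in lines -> x != y -> x \in L -> y \in L -> L = span x y.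
Proof.
move=> LL xy xL yL; have r2 := line_rank LL; have [flatL _ _] := linesP _ LL.
have dep z : z \in L -> z != x -> z != y -> z |: [set x; y] \notin indep M.
  move=> zL zx zy; apply/negP=> zxy; move: r2; rewrite leqNgt -(card_triple xy zx zy).
  by rewrite indep_le_rank // !subUset !sub1set zL xL.
apply/setP=> z; rewrite inE; apply/idP/or3P=> [zL|].
  have [->|zx] := eqVneq z x; first by constructor.
  have [->|zy] := eqVneq z y; first by constructor.
  by constructor; apply: dep.
(* A point [z] of the span outside [L] would raise the rank to 3; augmenting the pair then gives an
   independent triple containing [z] or inside [L], and both are excluded. *)
case=> [/eqP->//|/eqP->//|zxy]; apply: contraT => zL.
have /rank_ltP[I [iI IzL I3]] : (2 < mrank M (z |: L))%N.
  exact: leq_ltn_trans (rank_pair xy xL yL) (flatL z zL).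
have [w [wI wx wy wxy]] := augment_pair xy iI I3.
have /setU1P[wz|wL] := subsetP IzL w wI; first by rewrite -wz wxy in zxy.
by have := dep w wL wx wy; rewrite wxy.
Qed.

Lemma matroid_linear_space : linear_space lines.
Proof.
split.
- by move=> L /linesP[].
- by move=> L /linesP[_ _ /neq_setTP].
- move=> x y xy; exists (span x y); split; rewrite ?span_line // !inE eqxx ?orbT //.
- move=> x y L L' xy LL LL' xL yL xL' yL'.
  by rewrite (line_span LL xy xL yL) (line_span LL' xy xL' yL').
have [|I [_ _ I3]] := @rank_ltP [set: T] 2; first by rewrite rank3.
exact: leq_trans I3 (max_card _).
Qed.

(** Recovers the matroid from its lines: the dependent triples are the collinear ones. *)
Lemma indepE (A : {set T}) : (A \in indep M) =
  (#|A| <= 3)%N && ((2 < #|A|)%N ==> ~~ [exists L in lines, A \subset L]).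
Proof.
apply/idP/andP=> [iA|[A3 /implyP A2]].
  split; first by apply: leq_trans (indep_le_rank iA (subsetT A)) _; rewrite rank3.
  apply/implyP=> A3; apply/exists_inPn=> L LL; apply/negP=> AL.
  by have := leq_trans (indep_le_rank iA AL) (line_rank LL); rewrite leqNgt A3.
case: (leqP #|A| 2) => A2'; first exact: indep_le2.
move: (A2 A2') => /exists_inPn noL; apply: contraT => nA.
have /card_gt1P[x [y [xA yA xy]]] := ltnW A2'.
case/negP: (noL _ (span_line xy)); apply/subsetP=> z zA; rewrite inE.
have [//|zx] := eqVneq z x; have [//|zy] := eqVneq z y; rewrite /=.
suff <- : A = z |: [set x; y] by [].
apply/esym/eqP; rewrite eqEcard !subUset !sub1set xA yA zA /=.
by rewrite card_triple.
Qed.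

Lemma flat_cases (F : {set T}) : is_flat M F -> F != set0 -> F != setT ->
  (exists i, F = [set i]) \/ F \in lines.
Proof.
move=> flatF F0 FT; case: (ltngtP #|F| 1%N) => [|F1|/eqP/cards1P[i ->]].
- by rewrite ltnS leqn0 cards_eq0 (negPf F0).
- by right; apply/linesP.
by left; exists i.
Qed.

Lemma point_flat i : is_flat M [set i].
Proof.
move=> x; rewrite inE => xi; apply: (@leq_ltn_trans 1).
  by apply/rank_leP=> I _ /subset_leq_card; rewrite cards1.
by apply: (rank_pair xi); rewrite !inE eqxx ?orbT.
Qed.

End Matroid.

(** * Lattice points of the Bergman fan *)

Section Tropical.
Variables (R : realType) (N : nat) (u : 'I_N -> 'rV[int]_N).
Hypothesis basis : Zbasis u.
Local Notation e := (ray u).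

Lemma ray_lift i : e (lift ord0 i) = u i.
Proof. by rewrite /ray liftK. Qed.

Lemma ray0 : e ord0 = - \sum_j u j.
Proof. by rewrite /ray unlift_none. Qed.

Lemma ray_frame f g : wsum e f = wsum e g <-> forall x y, (f x + g y = f y + g x)%N.
Proof.
(* Coordinates in the basis [u] after eliminating the ray of index 0; they vanish exactly when [h]
   is constant. *)
pose c (h : 'I_N.+1 -> nat) : 'rV[int]_N := \row_i ((h (lift ord0 i))%:R - (h ord0)%:R).
have cE h : wsum e h = \sum_i c h 0 i *: u i.
  rewrite /wsum big_ord_recl ray0 mulNrn -sumrMnl -sumrN -big_split.
  apply: eq_bigr => i _; rewrite ray_lift mxE scalerBl !scaler_nat.
  by rewrite addrC.
split=> [E x y|E].
  have [d [_ uniq_d]] := basis (wsum e f).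
  have cfg : c f = c g by rewrite -(uniq_d _ (cE f)) -(uniq_d (c g)) // E cE.
  have {cfg} z x' : (f x' + g ord0 = f ord0 + g x')%N.
    case: (unliftP ord0 x') => [i ->|->] //.
    by have /rowP/(_ i) := cfg; rewrite !mxE !natz; lia.
  by have := z x; have := z y; clear; lia.
rewrite !cE; apply: eq_bigr => i _; congr (_ *: _).
by rewrite !mxE !natz; have := E (lift ord0 i) ord0; clear; lia.
Qed.

Local Notation real v := (map_mx (fun z : int => z%:~R) v : 'rV[R]_N).

Lemma realD (v w : 'rV[int]_N) : real (v + w) = real v + real w.
Proof. by apply/rowP=> i; rewrite !mxE intrD. Qed.

Lemma realMn (v : 'rV[int]_N) n : real (v *+ n) = real v *+ n.
Proof. by elim: n => [|n IH]; [apply/rowP=> i; rewrite !mxE | rewrite !mulrS realD IH]. Qed.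

Lemma realZ a (v : 'rV[int]_N) : real (a *: v) = a%:~R *: real v.
Proof. by apply/rowP=> i; rewrite !mxE intrM. Qed.

Lemma real_sum I (r : seq I) (Q : pred I) (F : I -> 'rV[int]_N) :
  real (\sum_(i <- r | Q i) F i) = \sum_(i <- r | Q i) real (F i).
Proof.
apply: (big_morph (fun v => real v) realD).
by apply/rowP=> i; rewrite !mxE.
Qed.

Lemma real_inj (v w : 'rV[int]_N) : real v = real w -> v = w.
Proof.
by move/rowP=> E; apply/rowP=> i; have := E i; rewrite !mxE => /intr_inj.
Qed.

(** Expanding the standard basis in [u] gives an inverse [C] of the matrix [U] of the basis, so
    freeness persists over the reals. *)
Lemma real_basis_free (h : 'I_N -> R) : \sum_i h i *: real (u i) = 0 -> forall i, h i = 0.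
Proof.
have /fin_all_exists[c cE] (k : 'I_N) : exists c : 'rV[int]_N,
    delta_mx 0 k = \sum_i c 0 i *: u i.
  by have [c [cE _]] := basis (delta_mx 0 k); exists c.
pose C : 'M[R]_N := \matrix_(k, i) (c k 0 i)%:~R.
pose U : 'M[R]_N := \matrix_i real (u i).
have CU : C *m U = 1%:M.
  apply/row_matrixP=> k; rewrite row_mul mulmx_sum_row row1.
  transitivity (real (delta_mx 0 k : 'rV[int]_N)).
    rewrite cE real_sum; apply: eq_bigr => i _.
    by rewrite realZ rowK !mxE.
  by apply/rowP=> i; rewrite !mxE; case: (_ && _).
move=> hE i; have: (\row_i h i) *m U = 0.
  by rewrite mulmx_sum_row -[RHS]hE; apply: eq_bigr => j _; rewrite rowK mxE.
move/(congr1 (mulmx^~ C)); rewrite -mulmxA (mulmx1C CU) mulmx1 mul0mx.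
by move/rowP/(_ i); rewrite !mxE.
Qed.

Lemma real_frame (h : 'I_N.+1 -> R) : \sum_j h j *: real (e j) = 0 ->
  forall j k, h j = h k.
Proof.
rewrite big_ord_recl => E.
have {}E : \sum_i (h (lift ord0 i) - h ord0) *: real (u i) = 0.
  rewrite -[RHS]E ray0.
  have -> : real (- \sum_j u j) = - \sum_j real (u j).
    by rewrite -real_sum; apply/rowP=> i; rewrite !mxE intrN.
  rewrite scalerN scaler_sumr -sumrN -big_split; apply: eq_bigr => i _.
  by rewrite ray_lift scalerBl addrC.
have z j : h j = h ord0.
  case: (unliftP ord0 j) => [i ->|->] //.
  by apply/eqP; rewrite -subr_eq0; apply/eqP/(real_basis_free E).
by move=> j k; rewrite !z.
Qed.

Lemma ray_sumE S : ray_sum R u S = real (flat_vec e S).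
Proof. by []. Qed.

(** The real coefficients are differences of integral weights of [v]: comparing [j] with [k] gives
    [b], then comparing [i] with [j] gives [a]. *)
Lemma integral_combination (i j k : 'I_N.+1) (L : {set 'I_N.+1}) (a b : R) v :
  0 <= a -> 0 <= b -> i \in L -> j \in L -> j != i -> k \notin L ->
  real v = a *: real (e i) + b *: real (flat_vec e L) ->
  exists m n : nat, v = e i *+ m + flat_vec e L *+ n.
Proof.
move=> a0 b0 iL jL ji kL vE.
have [g gE] : exists g : 'I_N.+1 -> int, v = \sum_j g j *: e j.
  have [c [cE _]] := basis v.
  exists (fun j => if unlift ord0 j is Some i then c 0 i else 0).
  rewrite big_ord_recl unlift_none scale0r add0r cE; apply: eq_bigr => l _.
  by rewrite liftK ray_lift.
pose h l : R := (l == i)%:R * a + (l \in L)%:R * b - (g l)%:~R.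
have hE l l' : h l = h l'.
  apply: real_frame; rewrite /h.
  transitivity (\sum_l ((l == i)%:R * a) *: real (e l) +
                \sum_l ((l \in L)%:R * b) *: real (e l) - \sum_l (g l)%:~R *: real (e l)).
    by rewrite -big_split -sumrB; apply: eq_bigr => m _; rewrite scalerBl scalerDl.
  have -> : \sum_l (g l)%:~R *: real (e l) = real v.
    by rewrite gE real_sum; apply: eq_bigr => m _; rewrite realZ.
  rewrite vE (bigD1 i) //= eqxx mul1r big1 => [|m /negPf->]; last by rewrite mul0r scale0r.
  rewrite addr0 real_sum scaler_sumr [X in _ + X - _](bigID (mem L)) /=.
  rewrite [X in _ + (_ + X) - _]big1 => [|m /negPf->]; last by rewrite mul0r scale0r.
  by rewrite addr0 (eq_bigr (fun m => b *: real (e m))) ?subrr // => m ->; rewrite mul1r.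
have ki : k != i by apply: contraNneq kL => ->.
have bE : b = (g j - g k)%:~R.
  have := hE j k; rewrite /h jL (negPf ji) (negPf kL) (negPf ki) intrB => /eqP.
  by rewrite !mul0r !add0r mul1r subr_eq addrC => /eqP.
have aE : a = (g i - g j)%:~R.
  have := hE i j; rewrite /h jL iL eqxx (negPf ji) intrB => /eqP.
  by rewrite !mul0r !add0r !mul1r subr_eq (addrC a) -addrA (inj_eq (addrI b)) addrC => /eqP.
move: a0 b0; rewrite aE bE !ler0z => /gez0_abs am /gez0_abs bn.
exists `|(g i - g j)%R|%N, `|(g j - g k)%R|%N; apply: real_inj.
by rewrite vE realD !realMn aE bE -am -bn -!scaler_nat.
Qed.

Variable M : matroid 'I_N.+1.
Hypotheses (simple : simple_matroid M) (rank3 : mrank M [set: 'I_N.+1] = 3%N).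
Let LS := matroid_linear_space simple rank3.

(** A chain of nonempty proper flats is at most a point inside a line; shorter flags are completed
    with zero coefficients. *)
Lemma flag_cases s (c : {set 'I_N.+1} -> R) : flag_of_flats M s -> (forall F, 0 <= c F) ->
  exists i L a b, [/\ L \in lines M, i \in L, 0 <= a, 0 <= b &
    \sum_(F <- s) c F *: ray_sum R u F = a *: real (e i) + b *: real (flat_vec e L)].
Proof.
move=> [ps fs] c0.
have one i : exists L a b, [/\ L \in lines M, i \in L, 0 <= a, 0 <= b &
    c [set i] *: ray_sum R u [set i] = a *: real (e i) + b *: real (flat_vec e L)].
  have [L LLs iL] := point_on_line LS i; exists L, (c [set i]), 0; split=> //.
  by rewrite ray_sumE flat_vec1 scale0r addr0.
case: s ps fs => [|F1 [|F2 s]] ps fs.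
- have [L LLs iL] := point_on_line LS ord0; exists ord0, L, 0, 0; split=> //.
  by rewrite big_nil !scale0r addr0.
- have /andP[F0 /andP[FT _]] := ps; rewrite proper0 in F0; rewrite properT in FT.
  have [[i F1i]|FL] := flat_cases (fs F1 (mem_head _ _)) F0 FT.
    have [L [a [b [? ? ? ? E]]]] := one i.
    by exists i, L, a, b; split; rewrite ?big_seq1 ?F1i.
  have [i [_ [iL _ _]]] := two_points LS FL.
  by exists i, F1, 0, (c F1); split; rewrite ?big_seq1 // scale0r add0r.
have /and3P[F0 F12 F2s] := ps; rewrite proper0 in F0.
have nonempty (A B : {set 'I_N.+1}) : A \proper B -> B != set0.
  by move=> AB; rewrite -proper0; apply: sub_proper_trans AB; rewrite sub0set.
have nonfull (A B : {set 'I_N.+1}) : A \proper B -> A != setT.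
  by move=> AB; rewrite -properT; apply: proper_sub_trans AB _; rewrite subsetT.
have next (F : {set 'I_N.+1}) r : path (fun A B : {set 'I_N.+1} => A \proper B) F
    (rcons r [set: 'I_N.+1]) -> F != setT.
  by case: r => [|G r] /= /andP[/nonfull].
have F2L : F2 \in lines M.
  have F2in : F2 \in [:: F1, F2 & s] by rewrite !inE eqxx orbT.
  have [[i F2i]|//] := flat_cases (fs F2 F2in) (nonempty _ _ F12) (next _ _ F2s).
  by move: (proper_card F12) F0; rewrite F2i cards1 ltnS leqn0 cards_eq0 => ->.
case: s F2s fs {ps} => [|F3 s] F2s fs; last first.
  have /andP[F23 F3s] := F2s.
  have F3in : F3 \in [:: F1, F2, F3 & s] by rewrite !inE eqxx !orbT.
  have [[i F3i]|F3L] := flat_cases (fs F3 F3in) (nonempty _ _ F23) (next _ _ F3s).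
    by move: (proper_card F23) (line_gt1 LS F2L); rewrite F3i cards1; clear; lia.
  by have := F23; rewrite (line_sub LS F2L F3L (proper_sub F23)) properxx.
have [[i F1i]|F1L] := flat_cases (fs F1 (mem_head _ _)) F0 (nonfull _ _ F12).
  exists i, F2, (c F1), (c F2); split=> //.
    by rewrite -sub1set -F1i proper_sub.
  by rewrite !big_cons big_nil addr0 !ray_sumE F1i flat_vec1.
by have := F12; rewrite (line_sub LS F1L F2L (proper_sub F12)) properxx.
Qed.

Lemma Trop_plane : plane (fun v => Trop R u M (real v)) e (lines M).
Proof.
split; [exact: LS | exact: ray_frame | move=> v; split].
  case=> s fs [c [c0 xE]].
  have [i [L [a [b [LLs iL a0 b0]]]]] := flag_cases fs c0; rewrite -xE => vE.
  have [j jL ji] := other_point LS i LLs; have [k kL] := line_neqT LS LLs.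
  have [m [n E]] := integral_combination a0 b0 iL jL ji kL vE.
  by exists i, L, m, n.
case=> i [L [a [b [LLs iL ->]]]]; have L1 := line_gt1 LS LLs.
have iLp : [set i] \proper L by rewrite properEcard sub1set iL cards1.
have [flatL _ LT] := linesP _ _ LLs.
exists [:: [set i]; L].
  split; first by rewrite /= proper0 -cards_eq0 cards1 iLp properT LT.
  by move=> F; rewrite !inE => /orP[]/eqP-> //; apply: point_flat.
(* Only the values at the two members of the flag matter. *)
exists (fun F => if F == L then b%:R else a%:R); split.
  by move=> F; case: ifP; rewrite ler0n.
rewrite !big_cons big_nil addr0 eqxx (negPf (proper_neq iLp)) !ray_sumE flat_vec1.
by rewrite realD !realMn !scaler_nat.
Qed.
End Tropical.

Lemma isomorphic_of_lines (T : finType) (M1 M2 : matroid T) (phi : T -> T) :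
  simple_matroid M1 -> simple_matroid M2 ->
  mrank M1 [set: T] = 3%N -> mrank M2 [set: T] = 3%N ->
  bijective phi -> preserves_lines (lines M1) (lines M2) phi ->
  isomorphic_matroids M1 M2.
Proof.
move=> s1 s2 r1 r2 phib pres; exists phi; split=> // A.
rewrite !indepE // card_imset; last exact: bij_inj phib.
congr (_ && _); case: (ltnP 2 #|A|) => // A3 /=; congr (~~ _).
by apply/exists_inP/exists_inP => /(pres A A3).
Qed.

Close Scope ring_scope.

Theorem proposition1 (R : realType) (N : nat) (M1 M2 : matroid 'I_N.+1)
    (u1 u2 : 'I_N -> 'rV[int]_N)
    (simple1 : simple_matroid M1) (simple2 : simple_matroid M2)
    (rank1 : mrank M1 [set: 'I_N.+1] = 3)
    (rank2 : mrank M2 [set: 'I_N.+1] = 3)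
    (basis1 : Zbasis u1) (basis2 : Zbasis u2)
    (eqTrop : Trop R u1 M1 = Trop R u2 M2) :
  isomorphic_matroids M1 M2.
Proof.
have PL1 := Trop_plane R basis1 simple1 rank1.
have PL2 := Trop_plane R basis2 simple2 rank2.
rewrite -eqTrop in PL2; have [phi phib pres] := planes_isomorphic PL1 PL2.
exact: isomorphic_of_lines simple1 simple2 rank1 rank2 phib pres.
Qed.
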